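(* Starting with an empty graph on $n$ vertices, under any sequence of edge insertions and deletions such that the arboricity of the graph remains bounded by $\gamma$ after every update, a proper $(\Delta+1)$-coloring can be maintained deterministically, performing at most one recoloring per update in the worst case, with amortized $O(\gamma + \log n)$ update time and worst-case $O(1)$ query time, where $\Delta$ is the maximum degree of a vertex.
   Context: The arboricity of a graph $G=(V,E)$ is $\max_{U\subseteq V}\lceil |E(U)|/(|U|-1)\rceil$, where $E(U)=\{\{u,v\}\in E: u,v\in U\}$. A proper $c$-coloring assigns each vertex a color in $\{1,\dots,c\}$ such that adjacent vertices receive different colors; the coloring is stored explicitly and a query returns the color of a given vertex. A recoloring is a change of the color of one vertex during an update.
   Formalization: Δ is taken as the largest vertex degree attained so far in the update sequence, since with the maximum degree of the current graph the one-recoloring claim already fails for n = 4, γ = 1. *)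

(* Defs.v *)
From mathcomp Require Import all_boot.
Set Implicit Arguments. Unset Strict Implicit. Unset Printing Implicit Defensive.

(** * Dynamic simple graphs on the vertex set ['I_n] *)

(* An edge is a two-element set of vertices. *)
Definition graph (n : nat) := {set {set 'I_n}}.

Section Graphs.
Variable n : nat.
Implicit Types (G : graph n) (U : {set 'I_n}).

Definition adj G (u v : 'I_n) : bool := (u != v) && ([set u; v] \in G).

Definition induced_edges G U : {set {set 'I_n}} := [set e in G | e \subset U].

Definition ceil_div (a b : nat) : nat := (a + b.-1) %/ b.

(* The quotient is meaningful only for #|U| >= 2. *)
Definition arboricity G : nat :=
  \max_(U : {set 'I_n} | 1 < #|U|) ceil_div #|induced_edges G U| (#|U| - 1).

Definition degree G (v : 'I_n) : nat := #|[set e in G | v \in e]|.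

Definition max_degree G : nat := \max_(v : 'I_n) degree G v.

Inductive op := Insert of 'I_n & 'I_n | Delete of 'I_n & 'I_n | Query of 'I_n.

Definition is_update (o : op) : bool := if o is Query _ then false else true.

Definition legal G (o : op) : bool :=
  match o with
  | Insert u v => (u != v) && ([set u; v] \notin G)
  | Delete u v => [set u; v] \in G
  | Query _ => true
  end.

Definition apply_op G (o : op) : graph n :=
  match o with
  | Insert u v => [set u; v] |: G
  | Delete u v => G :\ [set u; v]
  | Query _ => G
  end.

Fixpoint graph_at (ops : nat -> op) (i : nat) : graph n :=
  if i is j.+1 then apply_op (graph_at ops j) (ops j) else set0.

Definition admissible (gamma : nat) (ops : nat -> op) (T : nat) : Prop :=
  forall i, i < T ->
    legal (graph_at ops i) (ops i) /\ arboricity (graph_at ops i.+1) <= gamma.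

(* The largest degree a vertex has had so far.  For the maximum degree of the
   current graph the theorem would be false: after ab, cd and an edge joining
   two vertices of colour 1 have been inserted, the adversary can delete the
   edges of this path so that two vertices would have to be recoloured at once. *)
Definition Delta (ops : nat -> op) (i : nat) : nat :=
  \max_(j < i.+1) max_degree (graph_at ops j).

Definition num_updates (ops : nat -> op) (T : nat) : nat :=
  #|[set i : 'I_T | is_update (ops i)]|.

Definition proper_coloring G (c : nat) (col : 'I_n -> nat) : Prop :=
  (forall v, 1 <= col v <= c) /\ (forall u v, adj G u v -> col u <> col v).

Definition recolored (col col' : 'I_n -> nat) : {set 'I_n} :=
  [set v | col v != col' v].

End Graphs.

(** * Unit-cost word RAM with [w]-bit words, programmed by while programs *)

Inductive binop := OpAdd | OpSub | OpMul | OpDiv | OpMod | OpEq | OpLt.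

Inductive expr :=
  | Cst of nat
  | Reg of nat
  | Mem of expr
  | Bin of binop & expr & expr.

Inductive cmd :=
  | Skip
  | SetReg of nat & expr
  | Store of expr & expr
  | Seq of cmd & cmd
  | If of expr & cmd & cmd
  | While of expr & cmd.

Record store := MkStore { regs : nat -> nat; memory : nat -> nat }.

Definition upd (f : nat -> nat) (a x : nat) : nat -> nat :=
  fun b => if b == a then x else f b.

Definition set_reg (s : store) (r x : nat) : store :=
  MkStore (upd (regs s) r x) (memory s).

Definition set_mem (s : store) (a x : nat) : store :=
  MkStore (regs s) (upd (memory s) a x).

(* Subtraction is truncated at 0; x / 0 = 0 and x mod 0 = x. *)
Definition eval_op (o : binop) (x y : nat) : nat :=
  match o with
  | OpAdd => x + y
  | OpSub => x - y
  | OpMul => x * y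
  | OpDiv => x %/ y
  | OpMod => x %% y
  | OpEq => x == y
  | OpLt => x < y
  end.

(* Every value, hence also every address, is reduced to a w-bit word. *)
Fixpoint eval (w : nat) (s : store) (e : expr) : nat :=
  match e with
  | Cst k => k %% 2 ^ w
  | Reg r => regs s r %% 2 ^ w
  | Mem a => memory s (eval w s a) %% 2 ^ w
  | Bin o e1 e2 => eval_op o (eval w s e1) (eval w s e2) %% 2 ^ w
  end.

(* One time unit per constant, register access, memory access or operation. *)
Fixpoint cost (e : expr) : nat :=
  match e with
  | Cst _ | Reg _ => 1
  | Mem a => (cost a).+1
  | Bin _ e1 e2 => (cost e1 + cost e2).+1
  end.

(* exec w c s t s': on store s, program c halts in time t with store s'. *)
Inductive exec (w : nat) : cmd -> store -> nat -> store -> Prop :=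
  | ExecSkip s : exec w Skip s 1 s
  | ExecSetReg s r e :
      exec w (SetReg r e) s (cost e).+1 (set_reg s r (eval w s e))
  | ExecStore s a e :
      exec w (Store a e) s (cost a + cost e).+1
        (set_mem s (eval w s a) (eval w s e))
  | ExecSeq c1 c2 s s1 s2 t1 t2 :
      exec w c1 s t1 s1 -> exec w c2 s1 t2 s2 ->
      exec w (Seq c1 c2) s (t1 + t2) s2
  | ExecIfTrue e c1 c2 s s1 t :
      eval w s e <> 0 -> exec w c1 s t s1 ->
      exec w (If e c1 c2) s ((cost e).+1 + t) s1
  | ExecIfFalse e c1 c2 s s1 t :
      eval w s e = 0 -> exec w c2 s t s1 ->
      exec w (If e c1 c2) s ((cost e).+1 + t) s1
  | ExecWhileTrue e c s s1 s2 t1 t2 :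
      eval w s e <> 0 -> exec w c s t1 s1 -> exec w (While e c) s1 t2 s2 ->
      exec w (While e c) s ((cost e).+1 + t1 + t2) s2
  | ExecWhileFalse e c s :
      eval w s e = 0 -> exec w (While e c) s (cost e).+1 s.

Lemma exec_deterministic w c s t1 s1 t2 s2 :
  exec w c s t1 s1 -> exec w c s t2 s2 -> t1 = t2 /\ s1 = s2.
Proof.
move=> H; elim: H t2 s2 => {c s t1 s1}.
- by move=> s t2 s2 H; inversion H.
- by move=> s r e t2 s2 H; inversion H.
- by move=> s a e t2 s2 H; inversion H.
- move=> c1 c2 s s1 s2 t1 t2 _ IH1 _ IH2 t s' H; inversion H; subst.
  case: (IH1 _ _ ltac:(eassumption)) => ??; subst.
  by case: (IH2 _ _ ltac:(eassumption)) => ??; subst.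
- move=> e c1 c2 s s1 t He _ IH t2 s2 H; inversion H; subst => //.
  by case: (IH _ _ ltac:(eassumption)) => ??; subst.
- move=> e c1 c2 s s1 t He _ IH t2 s2 H; inversion H; subst => //.
  by case: (IH _ _ ltac:(eassumption)) => ??; subst.
- move=> e c s s1 s2 t1 t2 He _ IH1 _ IH2 t s' H; inversion H; subst => //.
  case: (IH1 _ _ ltac:(eassumption)) => ??; subst.
  by case: (IH2 _ _ ltac:(eassumption)) => ??; subst.
- by move=> e c s He t2 s2 H; inversion H; subst.
Qed.

(** * Dynamic colouring algorithms *)

Record algorithm := MkAlgorithm {
  init_prog : cmd;
  insert_prog : cmd;
  delete_prog : cmd;
  query_prog : cmd }.

(* Registers and memory are zero except for the input (n, gamma). *)
Definition start_store (n gamma : nat) : store :=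
  MkStore (upd (upd (fun=> 0) 0 n) 1 gamma) (fun=> 0).

Section Interface.
Variable n : nat.

Definition prog_of (A : algorithm) (o : op n) : cmd :=
  match o with
  | Insert _ _ => insert_prog A
  | Delete _ _ => delete_prog A
  | Query _ => query_prog A
  end.

(* Arguments are passed in registers 0 and 1; all else persists. *)
Definition pass_args (o : op n) (s : store) : store :=
  match o with
  | Insert u v | Delete u v => set_reg (set_reg s 0 u) 1 v
  | Query v => set_reg s 0 v
  end.

Definition answer (s : store) : nat := regs s 0.

(* The colouring is stored explicitly: memory cell v holds the colour of v. *)
Definition coloring (s : store) : 'I_n -> nat := fun v => memory s v.

End Interface.

(* Main.v *)
Require Import Defs.
From mathcomp Require Import all_boot zify.
Set Implicit Arguments. Unset Strict Implicit. Unset Printing Implicit Defensive.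

(** A free colour exists by the pigeonhole principle: once no arrow leaves u, every neighbour is
    counted, there are at most H of them, and the palette has H + 1 colours. Palettes never shrink;
    this is what spares deletions any recolouring, and it matches a colour bound in terms of the
    largest degree so far.

    The term 4 gamma is 2 times 2 gamma: an arrow out of u that the reference shares is paid for
    twice, once for its flip and once for the disagreement that the flip creates. A deletion removes
    the edge from both orientations, so phi does not rise. The reference is allowed 2 gamma rather
    than gamma because arboricity yields at most gamma (|W| - 1) arrows from a ball V into the next
    ball W; out-degrees of at least 2 gamma on V then force |W| > 2 |V|, and this factor 2 produces
    the logarithm.

    On the machine, everything is loop-free code of constant cost except two loops, the
    initialisation and the flips, so that only iterations have to be counted. Zeroed memory already
    encodes empty sets and zero counters, hence the tables of quadratic size need only linear
    initialisation. *)

(** Edges are kept oriented, and every vertex counts how many in-neighbours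
    have each colour, so that the colours among 1, ..., H + 1 (H the largest
    degree of the vertex so far) that no in-neighbour has form a set with
    constant-time updates.  When an edge joins two vertices of the same colour,
    all arrows out of one endpoint u are flipped.  Then all neighbours of u are
    in-neighbours, so any colour of its set is free, and as no arrow leaves u,
    no other vertex has to be told about the new colour.

    For the amortised cost, compare with a reference orientation of out-degree
    at most 2 gamma, and let phi be the number of arrows on which the two
    disagree.  Flipping k arrows out of u repairs all but 2 gamma of them, so
    k + phi' <= phi + 4 gamma.  An insertion changes the reference along a path
    of at most log n arrows: balls around a vertex in the reference double in
    size as long as they contain no vertex of out-degree less than 2 gamma. *)

(** * A language of array programs on top of the word RAM *)

(** The arguments are array number, row and column. The function is total; only the cells within the
    bounds of [represents] correspond to memory. *)
Definition arrays := nat -> nat -> nat -> nat.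

Definition write (f : arrays) (a x y z : nat) : arrays :=
  fun a' x' y' => if [&& a' == a, x' == x & y' == y] then z else f a' x' y'.

Inductive atom := Lit of nat | Rg of nat.

Definition aval (R : nat -> nat) (x : atom) : nat :=
  match x with Lit k => k | Rg r => R r end.

Definition below (b : nat) (x : atom) : bool :=
  match x with Lit _ => true | Rg r => r < b end.

(** There is deliberately no loop constructor: every program has a time bound that does not depend
    on the input. The two loops of the algorithm are built around compiled code with [While]. *)
Inductive ins :=
  | ISkip
  | ILd of nat & nat & atom & atom
  | ISt of nat & atom & atom & atom
  | IOp of nat & binop & atom & atom
  | ISeq of ins & ins
  | IIf of atom & ins & ins.

Declare Scope ins_scope.
Delimit Scope ins_scope with ins.
Bind Scope ins_scope with ins.
Notation "c1 ;; c2" := (ISeq c1 c2)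
  (at level 90, right associativity) : ins_scope.

(* This register holds the common row length n + 1 of all arrays. *)
Definition len_reg : nat := 30.

(** Layout: 0 holds the colours (in row 0), 1 to 3 the sets of out-neighbours, 4 to 6 the sets of
    free colours, 7 the counters, 8 the values [cap], 9 the degrees. *)
Definition num_arrays : nat := 10.

(* Cell (0, v) of array 0 is memory cell v, where the colour of v must be. *)
Definition addr (N a x y : nat) : nat := (a * N + x) * N + y.

Definition atom_expr (x : atom) : expr :=
  match x with Lit k => Cst k | Rg r => Reg r end.

Definition addr_expr (a : nat) (x y : atom) : expr :=
  Bin OpAdd
    (Bin OpMul (Bin OpAdd (Bin OpMul (Cst a) (Reg len_reg)) (atom_expr x))
      (Reg len_reg))
    (atom_expr y).

Fixpoint compile (i : ins) : cmd :=
  match i with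
  | ISkip => Skip
  | ILd r a x y => SetReg r (Defs.Mem (addr_expr a x y))
  | ISt a x y z => Store (addr_expr a x y) (atom_expr z)
  | IOp r o x y => SetReg r (Bin o (atom_expr x) (atom_expr y))
  | ISeq i1 i2 => Seq (compile i1) (compile i2)
  | IIf x i1 i2 => If (atom_expr x) (compile i1) (compile i2)
  end.

Fixpoint safe (i : ins) : bool :=
  match i with
  | ISkip => true
  | ILd r a _ _ => (r != len_reg) && (a < num_arrays)
  | ISt a _ _ _ => a < num_arrays
  | IOp r _ _ _ => r != len_reg
  | ISeq i1 i2 | IIf _ i1 i2 => safe i1 && safe i2
  end.

Fixpoint time_bound (i : ins) : nat :=
  match i with
  | ISkip => 1
  | ILd _ a x y => (cost (Defs.Mem (addr_expr a x y))).+1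
  | ISt a x y z => (cost (addr_expr a x y) + cost (atom_expr z)).+1
  | IOp _ o x y => (cost (Bin o (atom_expr x) (atom_expr y))).+1
  | ISeq i1 i2 => time_bound i1 + time_bound i2
  | IIf x i1 i2 => (cost (atom_expr x)).+1 + (time_bound i1 + time_bound i2)
  end.

(* Weakest precondition, including that no index or value overflows. *)
Fixpoint wp (N : nat) (i : ins) (Q : (nat -> nat) -> arrays -> Prop)
    (R : nat -> nat) (f : arrays) : Prop :=
  match i with
  | ISkip => Q R f
  | ILd r a x y =>
      [/\ aval R x < N, aval R y < N
        & Q (upd R r (f a (aval R x) (aval R y))) f]
  | ISt a x y z =>
      [/\ aval R x < N, aval R y < N, aval R z <= N
        & Q R (write f a (aval R x) (aval R y) (aval R z))]
  | IOp r o x y =>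
      [/\ aval R x <= N, aval R y <= N, eval_op o (aval R x) (aval R y) <= N
        & Q (upd R r (eval_op o (aval R x) (aval R y))) f]
  | ISeq i1 i2 => wp N i1 (wp N i2 Q) R f
  | IIf x i1 i2 =>
      aval R x <= N /\
      if aval R x == 0 then wp N i2 Q R f else wp N i1 Q R f
  end.

(** These rules hold by conversion or nearly so; as lemmas they unfold one instruction at a time and
    keep the rest of the program folded. *)
Lemma wp_seq N i1 i2 Q R f : wp N i1 (wp N i2 Q) R f -> wp N (i1 ;; i2)%ins Q R f.
Proof. by []. Qed.

Lemma wp_ld N r a x y Q R f : aval R x < N -> aval R y < N ->
  Q (upd R r (f a (aval R x) (aval R y))) f -> wp N (ILd r a x y) Q R f.
Proof. by []. Qed.

Lemma wp_st N a x y z Q R f : aval R x < N -> aval R y < N -> aval R z <= N ->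
  Q R (write f a (aval R x) (aval R y) (aval R z)) -> wp N (ISt a x y z) Q R f.
Proof. by []. Qed.

Lemma wp_op N r o x y Q R f : aval R x <= N -> aval R y <= N ->
  eval_op o (aval R x) (aval R y) <= N ->
  Q (upd R r (eval_op o (aval R x) (aval R y))) f -> wp N (IOp r o x y) Q R f.
Proof. by []. Qed.

Lemma wp_if N x i1 i2 Q R f : aval R x <= N ->
  (aval R x = 0 -> wp N i2 Q R f) -> (aval R x <> 0 -> wp N i1 Q R f) ->
  wp N (IIf x i1 i2) Q R f.
Proof. by move=> lx H2 H1; split=> //; case: eqP. Qed.

(** * Soundness of the weakest precondition for compiled code *)

Definition word_store (w : nat) (s : store) : Prop :=
  (forall r, regs s r < 2 ^ w) /\ (forall a, memory s a < 2 ^ w).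

Record represents (w N : nat) (s : store) (f : arrays) : Prop := Represents {
  rep_mem : forall a x y, a < num_arrays -> x < N -> y < N ->
    memory s (addr N a x y) = f a x y;
  rep_len : regs s len_reg = N;
  rep_word : word_store w s }.

(** [y] and [x] are the two lowest digits in base [N] and [a] is the remaining leading part, so
    division with remainder recovers all three. *)
Lemma addr_inj N a x y a' x' y' : x < N -> y < N -> x' < N -> y' < N ->
  addr N a x y = addr N a' x' y' -> [/\ a = a', x = x' & y = y'].
Proof.
move=> lx ly lx' ly' E.
have edi q r : r < N -> (q * N + r) %/ N = q /\ (q * N + r) %% N = r.
  move=> lr; have N0 : 0 < N by case: N lr {lx ly lx' ly' E}.
  by rewrite divnMDl // divn_small // addn0 modnMDl modn_small.
have [E1 E2] := edi (a * N + x) y ly; have [E1' E2'] := edi (a' * N + x') y' ly'.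
rewrite /addr in E; rewrite E in E1 E2.
have [F1 F2] := edi a x lx; have [F1' F2'] := edi a' x' lx'.
rewrite -E1 E1' in F1 F2.
by split; [rewrite -F1 F1' | rewrite -F2 F2' | rewrite -E2 E2'].
Qed.

Lemma addr_bound N a x y : a < num_arrays -> x < N -> y < N ->
  addr N a x y < num_arrays * N * N.
Proof. by rewrite /addr; nia. Qed.

Lemma word_store_set_reg w s r e :
  word_store w s -> word_store w (set_reg s r (eval w s e)).
Proof.
case=> H1 H2; split=> //= b; rewrite /upd; case: eqP => // _.
by case: e => *; rewrite /= ltn_mod expn_gt0.
Qed.

Lemma word_store_set_mem w s a e :
  word_store w s -> word_store w (set_mem s a (eval w s e)).
Proof.
case=> H1 H2; split=> //= b; rewrite /upd; case: eqP => // _.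
by case: e => *; rewrite /= ltn_mod expn_gt0.
Qed.

Lemma eval_atom w N s x : word_store w s -> N < 2 ^ w ->
  aval (regs s) x <= N -> eval w s (atom_expr x) = aval (regs s) x.
Proof. by case: x => x [H1 H2] lN le /=; rewrite modn_small // (leq_ltn_trans le). Qed.

Lemma eval_addr w N s f a x y : num_arrays * N * N <= 2 ^ w -> N < 2 ^ w ->
  represents w N s f -> a < num_arrays ->
  aval (regs s) x < N -> aval (regs s) y < N ->
  eval w s (addr_expr a x y) = addr N a (aval (regs s) x) (aval (regs s) y).
Proof.
move=> hw hN [_ lenE ws] la lx ly.
have ab := addr_bound la lx ly.
rewrite /= !(eval_atom ws hN) ?(ltnW lx) ?(ltnW ly) // lenE (modn_small hN).
move: ab; rewrite /addr => ab.
set X := aval _ x in lx ab *; set Y := aval _ y in ly ab *.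
have a1 : a < 2 ^ w by rewrite /num_arrays in la hw; nia.
have a2 : a * N < 2 ^ w by nia.
have a3 : a * N + X < 2 ^ w by nia.
have a4 : (a * N + X) * N < 2 ^ w by nia.
by rewrite !modn_small //; apply: leq_trans hw.
Qed.

(** The bounds collected by [wp] make every reduction modulo [2 ^ w] the identity, so machine and
    array semantics agree instruction by instruction. *)
Lemma wp_exec w N i Q s f : num_arrays * N * N <= 2 ^ w -> N < 2 ^ w ->
  safe i -> represents w N s f -> wp N i Q (regs s) f ->
  exists t s' f', [/\ exec w (compile i) s t s', t <= time_bound i,
                      represents w N s' f' & Q (regs s') f'].
Proof.
move=> hw hN; elim: i Q s f => [|r a x y|a x y z|r o x y|i1 IH1 i2 IH2|x i1 IH1 i2 IH2]
  Q s f /=.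
- by move=> _ rep HQ; exists 1, s, f; split=> //; constructor.
- case/andP=> /eqP nr la rep [lx ly HQ].
  have E : eval w s (Defs.Mem (addr_expr a x y)) = f a (aval (regs s) x) (aval (regs s) y).
    have [mem _ [_ H2]] := rep.
    rewrite -[LHS]/(memory s (eval w s (addr_expr a x y)) %% 2 ^ w).
    by rewrite (eval_addr hw hN rep) // modn_small // mem.
  eexists _, _, f; split; [exact: ExecSetReg|by []| |by rewrite -E in HQ].
  have [mem le ws] := rep; split=> //; last exact: word_store_set_reg.
  by rewrite /= /upd; case: eqP => // e; case: nr.
- move=> la rep [lx ly lz HQ].
  have [mem le ws] := rep.
  eexists _, _, _; split; [exact: ExecStore|by []| |exact: HQ].
  rewrite (eval_addr hw hN rep) //; split=> //; last exact: word_store_set_mem.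
  rewrite (eval_atom ws hN lz) => a' x' y' la' lx' ly'; rewrite /= /upd /write.
  case: and3P => [[/eqP-> /eqP-> /eqP->]|ne]; first by rewrite eqxx.
  case: eqP => [|_]; last exact: mem.
  by case/(addr_inj lx' ly' lx ly) => ea ex ey; case: ne; split; apply/eqP.
- move=> nr rep [lx ly lo HQ]; have [mem le ws] := rep.
  have E : eval w s (Bin o (atom_expr x) (atom_expr y)) =
           eval_op o (aval (regs s) x) (aval (regs s) y).
    by rewrite /= !(eval_atom ws hN) // modn_small // (leq_ltn_trans lo).
  eexists _, _, f; split; [exact: ExecSetReg|by []| |by rewrite -E in HQ].
  split=> //; last exact: word_store_set_reg.
  by rewrite /= /upd; case: eqP => // e; rewrite -e eqxx in nr.
- case/andP=> s1 s2 rep H.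
  have [t1 [s1' [f1 [e1 b1 rep1 H1]]]] := IH1 _ _ _ s1 rep H.
  have [t2 [s2' [f2 [e2 b2 rep2 H2]]]] := IH2 _ _ _ s2 rep1 H1.
  by exists (t1 + t2), s2', f2; split; [exact: ExecSeq e1 e2|exact: leq_add|..].
- case/andP=> s1 s2 rep [lx]; have E := eval_atom (rep_word rep) hN lx.
  case: eqP => ex H.
  + have [t [s' [f' [e b rep' H']]]] := IH2 _ _ _ s2 rep H.
    exists ((cost (atom_expr x)).+1 + t), s', f'; split=> //; last by lia.
    by apply: ExecIfFalse e; rewrite E.
  + have [t [s' [f' [e b rep' H']]]] := IH1 _ _ _ s1 rep H.
    exists ((cost (atom_expr x)).+1 + t), s', f'; split=> //; last by lia.
    by apply: ExecIfTrue e; rewrite E.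
Qed.

(** * Subsets of an initial segment with constant-time updates *)

(* Row x of array a lists the elements, row x of a + 1 gives 1 + their
   positions in this list (0 for non-elements), cell (x, 0) of a + 2 holds
   the cardinality. *)
Record is_set (N : nat) (f : arrays) (a x : nat) (S : nat -> bool) : Prop := IsSet {
  is_set_pos : forall y, y < N -> S y ->
    0 < f a.+1 x y <= f a.+2 x 0 /\ f a x (f a.+1 x y).-1 = y;
  is_set_pos0 : forall y, y < N -> ~~ S y -> f a.+1 x y = 0;
  is_set_arr : forall i, i < f a.+2 x 0 ->
    [/\ f a x i < N, S (f a x i) & f a.+1 x (f a x i) = i.+1] }.

(** Scratch registers are layered: 20 to 22 for sets, 13 to 15 for counters and degrees, numbers
    below 10 for the update procedures. Frame conditions thus reduce to comparing register
    numbers. *)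
Definition set_ins (a : nat) (x y : atom) : ins :=
  (ILd 20 a.+2 x (Lit 0) ;;
   ISt a x (Rg 20) y ;;
   IOp 20 OpAdd (Rg 20) (Lit 1) ;;
   ISt a.+1 x y (Rg 20) ;;
   ISt a.+2 x (Lit 0) (Rg 20))%ins.

(** The last element of the list moves into the hole. Its new position is written before the
    position of [y] is cleared, so the case where [y] itself is last needs no test. *)
Definition set_del (a : nat) (x y : atom) : ins :=
  (ILd 20 a.+1 x y ;;
   ILd 21 a.+2 x (Lit 0) ;;
   IOp 21 OpSub (Rg 21) (Lit 1) ;;
   ISt a.+2 x (Lit 0) (Rg 21) ;;
   ILd 22 a x (Rg 21) ;;
   ISt a.+1 x (Rg 22) (Rg 20) ;;
   ISt a.+1 x y (Lit 0) ;;
   IOp 20 OpSub (Rg 20) (Lit 1) ;;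
   ISt a x (Rg 20) (Rg 22))%ins.

Lemma aval_upd b x R r v : below b x -> b <= r -> aval (upd R r v) x = aval R x.
Proof. by case: x => //= q lq lr; rewrite /upd; case: eqP => // e; lia. Qed.

(** The positions invert the listing, so listed elements are distinct. The resulting bounds are what
    [wp] demands when a size is stored or used as an index. *)
Lemma is_set_size_count N f a x S :
  is_set N f a x S -> f a.+2 x 0 <= count S (iota 0 N).
Proof.
move=> [_ _ H]; rewrite -size_filter -(size_mkseq (f a x) (f a.+2 x 0)).
apply: uniq_leq_size.
  rewrite map_inj_in_uniq ?iota_uniq // => i j.
  rewrite !mem_iota !add0n => li lj E.
  have [_ _ Hi] := H _ li; have [_ _ Hj] := H _ lj.
  by move: Hi; rewrite E Hj => -[].
move=> y /mapP [i]; rewrite mem_iota add0n => li ->.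
by have [l1 l2 _] := H _ li; rewrite mem_filter mem_iota l1 l2.
Qed.

Lemma is_set_size N f a x S : is_set N f a x S -> f a.+2 x 0 <= N.
Proof.
move=> H; apply: leq_trans (is_set_size_count H) _.
by rewrite -{2}(size_iota 0 N) count_size.
Qed.

Lemma is_set_size_lt N f a x S y :
  is_set N f a x S -> y < N -> ~~ S y -> f a.+2 x 0 < N.
Proof.
move=> H ly nS; apply: leq_ltn_trans (is_set_size_count H) _.
rewrite -{2}(size_iota 0 N) -(count_predC S (iota 0 N)) -[X in X < _]addn0 ltn_add2l -has_count.
by apply/hasP; exists y => //; rewrite mem_iota.
Qed.

Lemma is_set_neq0 N f a x S y : is_set N f a x S -> y < N -> S y -> 0 < f a.+2 x 0.
Proof. by case=> H _ _ ly Sy; have [/andP[p q] _] := H _ ly Sy; apply: leq_trans q. Qed.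

Lemma eq_is_set N f f' a x S S' :
  (forall a' y, a <= a' <= a.+2 -> f' a' x y = f a' x y) -> (forall y, y < N -> S' y = S y) ->
  is_set N f a x S -> is_set N f' a x S'.
Proof.
move=> Ef ES [H1 H2 H3]; split.
- by move=> y ly; rewrite !Ef ?ES; [exact: H1|lia..].
- by move=> y ly; rewrite !Ef ?ES; [exact: H2|lia..].
- move=> i; rewrite !Ef; [|lia..] => /H3 [h1 h2 h3].
  by split; rewrite ?ES // Ef //; lia.
Qed.

Ltac solve_write := rewrite /write; repeat (case: ifP => ?); lia.

(** The postcondition [Q] is arbitrary and is only told the new set and what is preserved; in this
    continuation style specifications chain by [apply]. *)
Lemma wp_set_ins N a x y Q R f S :
  below 20 x -> below 20 y -> aval R x < N -> aval R y < N ->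
  is_set N f a (aval R x) S -> ~~ S (aval R y) ->
  (forall R' f', (forall r, r < 20 -> R' r = R r) ->
    is_set N f' a (aval R x) (fun z => (z == aval R y) || S z) ->
    (forall a' x' y', ~~ ((a <= a' <= a.+2) && (x' == aval R x)) ->
       f' a' x' y' = f a' x' y') -> Q R' f') ->
  wp N (set_ins a x y) Q R f.
Proof.
move=> bx b_y lx ly HS nS HQ.
have len := is_set_size_lt HS ly nS.
have eA r v R0 : 20 <= r -> (aval (upd R0 r v) x = aval R0 x) * (aval (upd R0 r v) y = aval R0 y).
  by move=> lr; split; apply: (@aval_upd 20).
rewrite /set_ins /= !eA // /upd /=.
set X := aval R x in lx HS HQ len *; set Y := aval R y in ly nS HQ *.
set L := f a.+2 X 0 in len *.
repeat (split; try lia).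
set f' := write _ _ _ _ _.
have E1 : f' a.+2 X 0 = L.+1 by rewrite /f'; solve_write.
have E2 z : f' a.+1 X z = if z == Y then L.+1 else f a.+1 X z.
  by rewrite /f'; solve_write.
have E3 z : f' a X z = if z == L then Y else f a X z by rewrite /f'; solve_write.
have E4 a' x' y' : ~~ ((a <= a' <= a.+2) && (x' == X)) -> f' a' x' y' = f a' x' y'.
  by move=> ne; rewrite /f'; solve_write.
apply: HQ => //.
  by move=> r lr; rewrite !ifF //; lia.
case: HS => H1 H2 H3; split.
- move=> z lz; rewrite E1 E2 E3; case: eqP => [->|nz] /= Sz; first by rewrite eqxx ltnSn.
  have [h1 h2] := H1 _ lz Sz; rewrite -/L in h1.
  by rewrite ifF; [split=> //; lia|lia].
- by move=> z lz; rewrite E2; case: eqP => //= nz; exact: H2.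
- move=> i; rewrite E1 E3 ltnS leq_eqVlt; case: eqP => [->|ni] /= li; first by rewrite eqxx E2 eqxx.
  have [h1 h2 h3] := H3 _ li; rewrite h2 orbT; split=> //.
  by rewrite E2; case: eqP => // E; move: nS; rewrite -E h2.
Qed.

Lemma wp_set_del N a x y Q R f S :
  below 20 x -> below 20 y -> aval R x < N -> aval R y < N ->
  is_set N f a (aval R x) S -> S (aval R y) ->
  (forall R' f', (forall r, r < 20 -> R' r = R r) ->
    is_set N f' a (aval R x) (fun z => (z != aval R y) && S z) ->
    (forall a' x' y', ~~ ((a <= a' <= a.+2) && (x' == aval R x)) ->
       f' a' x' y' = f a' x' y') -> Q R' f') ->
  wp N (set_del a x y) Q R f.
Proof.
move=> bx b_y lx ly HS SY HQ.
have len := is_set_size HS.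
have eA r v R0 : 20 <= r -> (aval (upd R0 r v) x = aval R0 x) * (aval (upd R0 r v) y = aval R0 y).
  by move=> lr; split; apply: (@aval_upd 20).
rewrite /set_del /= !eA // /upd /=.
set X := aval R x in lx HS HQ len *; set Y := aval R y in ly SY HQ *.
set L := f a.+2 X 0 in len *; set P := f a.+1 X Y.
rewrite (_ : write f _ _ _ _ _ _ _ = f a X (L - 1)); last by solve_write.
case: HS => H1 H2 H3.
have [lP HP] := H1 _ ly SY; rewrite -/P -/L in lP HP.
have lL : L - 1 < L by lia.
have [Z1 Z2 Z3] := H3 _ lL; set Z := f a X (L - 1) in Z1 Z2 Z3 *.
repeat (split; try lia).
set f' := write _ _ _ _ _.
have E1 : f' a.+2 X 0 = L.-1 by rewrite /f'; solve_write.
have E2 z : f' a.+1 X z = if z == Y then 0 else if z == Z then P else f a.+1 X z.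
  by rewrite /f'; solve_write.
have E3 z : f' a X z = if z == P.-1 then Z else f a X z by rewrite /f'; solve_write.
have E4 a' x' y' : ~~ ((a <= a' <= a.+2) && (x' == X)) -> f' a' x' y' = f a' x' y'.
  by move=> ne; rewrite /f'; solve_write.
apply: HQ => //.
  by move=> r lr; rewrite !ifF //; lia.
split.
- move=> z lz /andP[nz Sz]; rewrite E1 E2 E3 (negPf nz).
  have [h1 h2] := H1 _ lz Sz; rewrite -/L in h1.
  (* The last list position belongs to [Z] alone, so every other element keeps a position within the
     shortened list. *)
  have nP : z <> Z -> f a.+1 X z <> L by move=> nZ E; apply: nZ; rewrite -h2 E /Z subn1.
  case: (z =P Z) => [zZ|nZ].
    have : P <> L by move=> E; case/eqP: nz; rewrite zZ /Z -E subn1 HP.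
    by rewrite eqxx; split=> //; lia.
  split; first by have := nP nZ; lia.
  by case: eqP => // E; case/eqP: nz; rewrite -h2 E HP.
- move=> z lz; rewrite E2; case: (z =P Y) => //= nz Sz.
  by case: eqP => [E|_]; [rewrite E Z2 in Sz|exact: H2].
- move=> i; rewrite E1 E3 => li; case: (i =P P.-1) => [Ei|ni] /=.
    have nZY : Z <> Y by move=> E; rewrite E -/P in Z3; lia.
    by rewrite E2 eqxx; move/eqP: (nZY) => /negPf ->; split=> //; lia.
  have li' : i < L by lia.
  have [h1 h2 h3] := H3 _ li'.
  have nY : f a X i <> Y by move=> E; rewrite E -/P in h3; lia.
  have nZ : f a X i <> Z by move=> E; rewrite E Z3 in h3; lia.
  by rewrite E2; move/eqP: nY => /negPf ->; move/eqP: nZ => /negPf ->.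
Qed.

(** * The data structure *)

(* [arrow u v]: the edge uv is oriented from u to v.
   [cnt v c]: the number of in-neighbours of v with colour c.
   [cap v]: one plus the largest degree that v has had so far; the colours in
   1..cap v that no in-neighbour of v has are kept in a set. *)
Record dstate := DState {
  arrow : nat -> nat -> bool;
  hue : nat -> nat;
  cnt : nat -> nat -> nat;
  cap : nat -> nat;
  deg : nat -> nat }.

Definition upd2 (T : Type) (g : nat -> nat -> T) (x y : nat) (z : T) :=
  fun x' y' => if (x' == x) && (y' == y) then z else g x' y'.

Definition with_arrow (g : dstate) x y b :=
  DState (upd2 (arrow g) x y b) (hue g) (cnt g) (cap g) (deg g).
Definition with_cnt (g : dstate) x c k :=
  DState (arrow g) (hue g) (upd2 (cnt g) x c k) (cap g) (deg g).
Definition with_hue (g : dstate) x c :=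
  DState (arrow g) (upd (hue g) x c) (cnt g) (cap g) (deg g).
Definition with_deg (g : dstate) x d :=
  DState (arrow g) (hue g) (cnt g) (cap g) (upd (deg g) x d).
Definition with_cap (g : dstate) x d :=
  DState (arrow g) (hue g) (cnt g) (upd (cap g) x d) (deg g).

Definition free_hue (g : dstate) (v c : nat) : bool :=
  (0 < c <= cap g v) && (cnt g v c == 0).

Record implements (n : nat) (f : arrays) (g : dstate) : Prop := Implements {
  imp_hue : forall v, v < n -> f 0 0 v = hue g v;
  imp_arrow : forall v, v < n -> is_set n.+1 f 1 v (arrow g v);
  imp_free : forall v, v < n -> is_set n.+1 f 4 v (free_hue g v);
  imp_cnt : forall v c, v < n -> c <= n -> f 7 v c = cnt g v c;
  imp_cap : forall v, v < n -> f 8 v 0 = cap g v;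
  imp_deg : forall v, v < n -> f 9 v 0 = deg g v }.

(** An in-neighbour may have a colour above [cap]: it is counted but never listed as free. Here
    position 0 in array 5 reveals this; [decr_cnt] compares with [cap], and [grow] consults the
    counter when the palette reaches the colour. *)
Definition incr_cnt (x c : atom) : ins :=
  (ILd 13 5 x c ;;
   IIf (Rg 13) (set_del 4 x c) ISkip ;;
   ILd 13 7 x c ;;
   IOp 13 OpAdd (Rg 13) (Lit 1) ;;
   ISt 7 x c (Rg 13))%ins.

Definition decr_cnt (x c : atom) : ins :=
  (ILd 13 7 x c ;;
   IOp 13 OpSub (Rg 13) (Lit 1) ;;
   ISt 7 x c (Rg 13) ;;
   IIf (Rg 13) ISkip
     (ILd 14 8 x (Lit 0) ;;
      IOp 14 OpLt (Rg 14) c ;;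
      IIf (Rg 14) ISkip (set_ins 4 x c)))%ins.

(** Degrees rise by one at a time, so the record is broken exactly when the new degree equals [cap].
    No procedure lowers [cap]. *)
Definition grow (x : atom) : ins :=
  (ILd 13 9 x (Lit 0) ;;
   IOp 13 OpAdd (Rg 13) (Lit 1) ;;
   ISt 9 x (Lit 0) (Rg 13) ;;
   ILd 14 8 x (Lit 0) ;;
   IOp 15 OpEq (Rg 13) (Rg 14) ;;
   IIf (Rg 15)
     (IOp 14 OpAdd (Rg 14) (Lit 1) ;;
      ISt 8 x (Lit 0) (Rg 14) ;;
      ILd 13 7 x (Rg 14) ;;
      IIf (Rg 13) ISkip (set_ins 4 x (Rg 14)))
     ISkip)%ins.

Definition shrink (x : atom) : ins :=
  (ILd 13 9 x (Lit 0) ;;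
   IOp 13 OpSub (Rg 13) (Lit 1) ;;
   ISt 9 x (Lit 0) (Rg 13))%ins.

Lemma below_weaken b b' x : b <= b' -> below b x -> below b' x.
Proof. by case: x => //= r lb lr; apply: leq_trans lb. Qed.

Lemma implements_with_cnt n f f' g x c k :
  (forall a y z, ~~ (4 <= a <= 7) -> f' a y z = f a y z) ->
  (forall v, v < n -> is_set n.+1 f' 4 v (free_hue (with_cnt g x c k) v)) ->
  (forall y z, f' 7 y z = if (y == x) && (z == c) then k else f 7 y z) ->
  implements n f g -> implements n f' (with_cnt g x c k).
Proof.
move=> E H4 H7 [h1 h2 h3 h4 h5 h6]; split=> //=.
- by move=> v lv; rewrite E // h1.
- by move=> v lv; apply: eq_is_set (h2 _ lv) => // a y la; apply: E; lia.
- by move=> v d lv ld; rewrite H7 /upd2 h4.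
- by move=> v lv; rewrite E // h5.
- by move=> v lv; rewrite E // h6.
Qed.

Lemma wp_incr_cnt n x c Q R f g :
  below 10 x -> below 10 c -> aval R x < n -> aval R c <= n ->
  implements n f g -> cnt g (aval R x) (aval R c) <= n ->
  (forall R' f', (forall r, r < 10 -> R' r = R r) ->
    implements n f' (with_cnt g (aval R x) (aval R c) (cnt g (aval R x) (aval R c)).+1) ->
    Q R' f') ->
  wp n.+1 (incr_cnt x c) Q R f.
Proof.
move=> bx bc lx lc I lk HQ.
have bx' := below_weaken (isT : 10 <= 20) bx; have bc' := below_weaken (isT : 10 <= 20) bc.
have eA r v R0 : 10 <= r -> (aval (upd R0 r v) x = aval R0 x) * (aval (upd R0 r v) c = aval R0 c).
  by move=> lr; split; apply: (@aval_upd 10).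
have eP R' : (forall r, r < 10 -> R' r = R r) -> (aval R' x = aval R x) * (aval R' c = aval R c).
  by move=> E; split; [case: (x) bx|case: (c) bc] => //= r lr; apply: E.
set X := aval R x in lx HQ lk *; set C := aval R c in lc HQ lk *.
have IS := imp_free I lx.
(* The counter update shared by both branches. The free set is already required to fit the new count
   before that count is stored. *)
have tail R1 f1 : (forall r, r < 10 -> R1 r = R r) ->
    (forall a y z, ~~ (4 <= a <= 6) -> f1 a y z = f a y z) ->
    (forall v, v < n -> is_set n.+1 f1 4 v (free_hue (with_cnt g X C (cnt g X C).+1) v)) ->
    wp n.+1 (ILd 13 7 x c ;; IOp 13 OpAdd (Rg 13) (Lit 1) ;; ISt 7 x c (Rg 13))%ins Q R1 f1.
  move=> ER Ef Hs; rewrite /= !eA // !(eP _ ER) -/X -/C /upd /= Ef // (imp_cnt I) //.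
  repeat (split; try lia); rewrite addn1.
  apply: HQ; first by move=> r lr; rewrite !ifF ?ER //; lia.
  apply: (implements_with_cnt _ _ _ (I)).
  - by move=> a y z la; rewrite -Ef; [solve_write|lia].
  - by move=> v lv; apply: eq_is_set (Hs _ lv) => // a y la; solve_write.
  - by move=> y z; rewrite -Ef //; solve_write.
have XC : free_hue (with_cnt g X C (cnt g X C).+1) X C = false.
  by rewrite /free_hue /= /upd2 !eqxx /= andbF.
have Xz v z : ~~ ((v == X) && (z == C)) -> free_hue (with_cnt g X C (cnt g X C).+1) v z = free_hue g v z.
  by move=> ne; rewrite /free_hue /= /upd2 (negPf ne).
have posE : (f 5 X C <= n.+1) * (free_hue g X C = (f 5 X C != 0)).
  have lN := is_set_size IS; case: (boolP (free_hue g X C)) => S.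
    by have [] := is_set_pos IS (lc : C < n.+1) S; split; lia.
  by rewrite (is_set_pos0 IS).
apply/wp_seq/wp_ld; [exact: leqW|by []|apply: wp_seq]; rewrite -/X -/C.
have eR : aval (upd R 13 (f 5 X C)) (Rg 13) = f 5 X C by [].
apply: wp_if; rewrite eR; first by rewrite posE.
  move=> P0; apply: tail => //; first by move=> r lr; rewrite /upd ifF //; lia.
  move=> v lv; apply: eq_is_set (imp_free I lv) => // z lz.
  case: (boolP ((v == X) && (z == C))) => [/andP[/eqP-> /eqP->]|ne]; last exact: Xz.
  by rewrite XC posE P0.
move=> P0; apply: (wp_set_del (S := free_hue g X)); rewrite ?eA -/X -/C //.
- exact: leqW.
- by rewrite posE; apply/eqP.
move=> R1 f1 ER HS Ef; apply: tail => [r lr|a y z la|v lv].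
- by rewrite ER; [rewrite /upd ifF //|]; lia.
- by apply: Ef; lia.
- case: (v =P X) => [->|nv].
    apply: eq_is_set HS => // z lz; case: (z =P C) => [->|nz] /=; first by rewrite XC.
    by rewrite Xz //; apply/negP => /andP[_ /eqP].
  apply: eq_is_set (imp_free I lv) => [a y la|z lz]; first by apply: Ef; lia.
  by rewrite Xz //; apply/negP => /andP[/eqP].
Qed.

Lemma wp_decr_cnt n x c Q R f g :
  below 10 x -> below 10 c -> aval R x < n -> 0 < aval R c <= n ->
  implements n f g -> 0 < cnt g (aval R x) (aval R c) <= n -> cap g (aval R x) <= n ->
  (forall R' f', (forall r, r < 10 -> R' r = R r) ->
    implements n f' (with_cnt g (aval R x) (aval R c) (cnt g (aval R x) (aval R c)).-1) ->
    Q R' f') ->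
  wp n.+1 (decr_cnt x c) Q R f.
Proof.
move=> bx bc lx lc I lk lcap HQ.
have bx' := below_weaken (isT : 10 <= 20) bx; have bc' := below_weaken (isT : 10 <= 20) bc.
have eA r v R0 : 10 <= r -> (aval (upd R0 r v) x = aval R0 x) * (aval (upd R0 r v) c = aval R0 c).
  by move=> lr; split; apply: (@aval_upd 10).
have Ec := imp_cnt I lx (proj2 (andP lc)).
set X := aval R x in lx HQ lk lcap Ec *; set C := aval R c in lc HQ lk Ec *.
have IS := imp_free I lx.
set k := cnt g X C in HQ lk Ec *; set f1 := write f 7 X C k.-1.
have E1 a y z : a != 7 -> f1 a y z = f a y z by move=> na; rewrite /f1; solve_write.
have E7 y z : f1 7 y z = if (y == X) && (z == C) then k.-1 else f 7 y z by rewrite /f1; solve_write.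
have Xz v z : ~~ ((v == X) && (z == C)) -> free_hue (with_cnt g X C k.-1) v z = free_hue g v z.
  by move=> ne; rewrite /free_hue /= /upd2 (negPf ne).
have nS : free_hue g X C = false by rewrite /free_hue -/k; lia.
have XC : free_hue (with_cnt g X C k.-1) X C = (C <= cap g X) && (k.-1 == 0).
  by rewrite /free_hue /= /upd2 !eqxx /=; lia.
(* This serves two branches: the count stays positive, or [C] lies above the palette. In both the
   free set is unchanged. *)
have same : free_hue (with_cnt g X C k.-1) X C = false -> implements n f1 (with_cnt g X C k.-1).
  move=> nS'; apply: (implements_with_cnt _ _ _ (I)) => [a y z la|v lv|//].
    by apply: E1; lia.
  apply: eq_is_set (imp_free I lv) => [a y la|z lz]; first by apply: E1; lia.
  case: (boolP ((v == X) && (z == C))) => [/andP[/eqP-> /eqP->]|ne]; last exact: Xz.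
  by rewrite nS nS'.
apply/wp_seq/wp_ld; [exact: leqW|by rewrite -/C; lia|apply/wp_seq/wp_op]; rewrite -/X -/C Ec.
- by rewrite /= /upd /=; lia.
- by [].
- by rewrite /= /upd /=; lia.
set R1 := upd _ _ _.
have ER1 : (aval R1 x = X) * (aval R1 c = C) * (aval R1 (Rg 13) = k.-1).
  by rewrite /R1 !eA // /X /C /= /upd eqxx subn1.
have low1 r : r < 10 -> R1 r = R r by move=> lr; rewrite /R1 /upd !ifF //; lia.
apply/wp_seq/wp_st; rewrite ?ER1; [exact: leqW|by lia|by lia|].
rewrite -/f1; apply: wp_if; rewrite ER1; first by lia.
  move=> k0; apply/wp_seq/wp_ld; rewrite ?ER1; [exact: leqW|by []|].
  rewrite E1 // (imp_cap I lx); set R2 := upd _ _ _.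
  have ER2 : (aval R2 x = X) * (aval R2 c = C) * (aval R2 (Rg 14) = cap g X).
    by rewrite /R2 !eA // !ER1.
  apply/wp_seq/wp_op; rewrite ?ER2; [by lia|by lia|by rewrite /=; lia|].
  set R3 := upd _ _ _.
  have ER3 : (aval R3 x = X) * (aval R3 c = C) * (aval R3 (Rg 14) = (cap g X < C)).
    by rewrite /R3 !eA // !ER2.
  have low3 r : r < 10 -> R3 r = R r.
    by move=> lr; rewrite -low1 // /R3 /R2 /upd !ifF //; lia.
  apply: wp_if; rewrite ER3; first by lia.
    move=> lt; apply: (wp_set_ins (S := free_hue g X)); rewrite ?ER3 //.
    - exact: leqW.
    - by lia.
    - by apply: eq_is_set IS => // a y la; apply: E1; lia.
    - by rewrite nS.
    move=> R4 f4 ER4 HS Ef; apply: HQ; first by move=> r lr; rewrite ER4 ?low3 //; lia.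
    apply: (implements_with_cnt _ _ _ (I)) => [a y z la|v lv|y z].
    + by rewrite Ef ?E1 //; lia.
    + case: (v =P X) => [->|nv].
        apply: eq_is_set HS => // z lz; case: (z =P C) => [->|nz] /=; first by rewrite XC; lia.
        by rewrite Xz //; apply/negP => /andP[_ /eqP].
      apply: eq_is_set (imp_free I lv) => [a y la|z lz]; first by rewrite Ef ?E1 //; lia.
      by rewrite Xz //; apply/negP => /andP[/eqP].
    + by rewrite Ef // E7.
  by move=> gt; apply: HQ => //; apply: same; rewrite XC; lia.
by move=> k0; apply: HQ => //; apply: same; rewrite XC; lia.
Qed.

Definition grown (g : dstate) (x : nat) : dstate :=
  let d := (deg g x).+1 in
  if d == cap g x then with_cap (with_deg g x d) x d.+1 else with_deg g x d.

Lemma aval_low b R R' x :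
  (forall r, r < b -> R' r = R r) -> below b x -> aval R' x = aval R x.
Proof. by case: x => //= r E; exact: E. Qed.

Lemma implements_with_deg n f g x d :
  implements n f g -> implements n (write f 9 x 0 d) (with_deg g x d).
Proof.
case=> h1 h2 h3 h4 h5 h6; split=> //=.
- by move=> v lv; apply: eq_is_set (h2 _ lv) => // a y la; solve_write.
- by move=> v lv; apply: eq_is_set (h3 _ lv) => // a y la; solve_write.
- by move=> v lv; rewrite /write /upd /= andbT; case: eqP => // _; exact: h6.
Qed.

Lemma wp_grow n x Q R f g :
  below 10 x -> aval R x < n -> implements n f g ->
  deg g (aval R x) < cap g (aval R x) <= n -> (deg g (aval R x)).+1 < n ->
  (forall c, cnt g (aval R x) c <= n) ->
  (forall R' f', (forall r, r < 10 -> R' r = R r) ->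
    implements n f' (grown g (aval R x)) -> Q R' f') ->
  wp n.+1 (grow x) Q R f.
Proof.
move=> bx lx I ld ld' lcnt HQ; have bx' := below_weaken (isT : 10 <= 20) bx.
have Ed := imp_deg I lx; have Ec := imp_cap I lx.
set X := aval R x in lx ld ld' lcnt HQ Ed Ec.
have lX : X < n.+1 by apply: leqW.
have low R' : (forall r, r < 10 -> R' r = R r) -> aval R' x = X by move=> E; apply: aval_low E bx.
have step r v R' : 10 <= r -> (forall q, q < 10 -> R' q = R q) ->
    forall q, q < 10 -> upd R' r v q = R q.
  by move=> lr E q lq; rewrite /upd ifF ?E //; lia.
set d := deg g X in ld ld' Ed; set g1 := with_deg g X d.+1.
set f1 := write f 9 X 0 d.+1.
have I1 : implements n f1 g1 by apply: implements_with_deg.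
apply/wp_seq/wp_ld => //; rewrite -/X Ed; set R1 := upd _ _ _.
have low1 : forall r, r < 10 -> R1 r = R r by apply: step.
have R1E : aval R1 (Rg 13) = d by [].
apply/wp_seq/wp_op; rewrite ?R1E //; [by lia|by rewrite /=; lia|].
rewrite [eval_op _ _ _]/= addn1; set R2 := upd _ _ _.
have low2 : forall r, r < 10 -> R2 r = R r by apply: step.
have R2E : aval R2 (Rg 13) = d.+1 by [].
apply/wp_seq/wp_st; rewrite ?low ?R2E //; [by lia|].
rewrite -/f1; apply/wp_seq/wp_ld; rewrite ?low // [f1 8 _ _](imp_cap I1 lx).
set R3 := upd _ _ _; have low3 : forall r, r < 10 -> R3 r = R r by apply: step.
have R3E : (aval R3 (Rg 13) = d.+1) * (aval R3 (Rg 14) = cap g X) by [].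
apply/wp_seq/wp_op; rewrite ?R3E; [by lia|by lia|by rewrite /=; lia|].
set R4 := upd _ _ _; have low4 : forall r, r < 10 -> R4 r = R r by apply: step.
have R4E : (aval R4 (Rg 15) = (d.+1 == cap g X)) * (aval R4 (Rg 14) = cap g X) by [].
apply: wp_if; rewrite ?R4E; first by lia.
  by move=> ne; apply: HQ => //; rewrite /grown -/d; case: eqP ne.
move=> /eqP; rewrite eqb0 negbK => /eqP E.
apply/wp_seq/wp_op; rewrite ?R4E //; [by lia|by rewrite /=; lia|].
rewrite [eval_op _ _ _]/= addn1 -E; set R5 := upd _ _ _.
have low5 : forall r, r < 10 -> R5 r = R r by apply: step.
have R5E : aval R5 (Rg 14) = d.+2 by [].
apply/wp_seq/wp_st; rewrite ?low ?R5E //; [by lia|].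
set f2 := write f1 8 X _ d.+2.
have E2 a y z : a != 8 -> f2 a y z = f1 a y z by move=> na; rewrite /f2; solve_write.
apply/wp_seq/wp_ld; rewrite ?low ?R5E //.
rewrite E2 // (imp_cnt I1) //; set R6 := upd _ _ _.
have low6 : forall r, r < 10 -> R6 r = R r by apply: step.
have R6E : (aval R6 (Rg 13) = cnt g X d.+2) * (aval R6 (Rg 14) = d.+2) by [].
have G : grown g X = with_cap g1 X d.+2 by rewrite /grown -/d E eqxx -E.
have fin R' f' : (forall r, r < 10 -> R' r = R r) ->
    (forall a y z, ~~ (4 <= a <= 6) -> f' a y z = f2 a y z) ->
    (forall v, v < n -> is_set n.+1 f' 4 v (free_hue (with_cap g1 X d.+2) v)) ->
    Q R' f'.
  move=> lo E' S'; apply: HQ => //; rewrite G.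
  have [h1 h2 h3 h4 h5 h6] := I1; split=> //=.
  - by move=> v lv; rewrite E' // E2 // h1.
  - by move=> v lv; apply: eq_is_set (h2 _ lv) => // a y la; rewrite E' ?E2 //; lia.
  - by move=> v c lv lc; rewrite E' // E2 // h4.
  - by move=> v lv; rewrite E' // /f2 /write /upd eqxx /= andbT; case: eqP => // _; apply: h5.
  - by move=> v lv; rewrite E' // E2 // h6.
have FH v z : ~~ ((v == X) && (z == d.+2)) ->
    free_hue (with_cap g1 X d.+2) v z = free_hue g1 v z.
  by rewrite /free_hue /= /upd; case: (v =P X) => //= ->; rewrite -E; lia.
have nF : free_hue g1 X d.+2 = false by rewrite /free_hue /= -E; lia.
have HS v : v < n -> is_set n.+1 f2 4 v (free_hue g1 v).
  by move=> lv; apply: eq_is_set (imp_free I1 lv) => // a y la; rewrite E2 //; lia.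
have XX : free_hue (with_cap g1 X d.+2) X d.+2 = (cnt g X d.+2 == 0).
  by rewrite /free_hue /= /upd eqxx leqnn.
apply: wp_if; rewrite ?R6E; first exact: leqW.
  move=> c0; apply: (wp_set_ins (S := free_hue g1 X)); rewrite ?low ?R6E //.
  - exact: HS.
  - by rewrite nF.
  move=> R7 f7 ER HS7 Ef; apply: fin => [r lr|a y z la|v lv].
  - by rewrite ER ?low6 //; lia.
  - by apply: Ef; lia.
  - case: (v =P X) => [->|nv].
      apply: eq_is_set HS7 => // z lz; case: (z =P d.+2) => [->|nz] /=.
        by rewrite XX c0.
      by rewrite FH //; apply/negP => /andP[_ /eqP].
    apply: eq_is_set (HS _ lv) => [a y la|z lz]; first by apply: Ef; lia.
    by rewrite FH //; apply/negP => /andP[/eqP].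
move=> c0; apply: fin => // v lv; apply: eq_is_set (HS _ lv) => // z lz.
case: (boolP ((v == X) && (z == d.+2))) => [/andP[/eqP-> /eqP->]|]; last exact: FH.
by rewrite nF XX; apply/eqP.
Qed.

Lemma wp_shrink n x Q R f g :
  below 10 x -> aval R x < n -> implements n f g -> deg g (aval R x) <= n ->
  (forall R' f', (forall r, r < 10 -> R' r = R r) ->
    implements n f' (with_deg g (aval R x) (deg g (aval R x)).-1) -> Q R' f') ->
  wp n.+1 (shrink x) Q R f.
Proof.
move=> bx lx I ld HQ; have Ed := imp_deg I lx.
have E r v R' : 10 <= r -> aval (upd R' r v) x = aval R' x by apply: aval_upd.
rewrite /= !E // Ed /upd /=; repeat (split; try lia).
rewrite subn1; apply: HQ; last exact: implements_with_deg.
by move=> r lr; rewrite !ifF //; lia.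
Qed.

Lemma implements_with_arrow n f f' g x y b :
  (forall a x' y', ~~ ((1 <= a <= 3) && (x' == x)) -> f' a x' y' = f a x' y') ->
  is_set n.+1 f' 1 x (arrow (with_arrow g x y b) x) ->
  implements n f g -> implements n f' (with_arrow g x y b).
Proof.
move=> E S [h1 h2 h3 h4 h5 h6]; split=> //=.
- by move=> v lv; rewrite E // h1.
- move=> v lv; case: (v =P x) => [->|nv] //.
  apply: eq_is_set (h2 _ lv) => [a z la|z lz]; first by apply: E; lia.
  by rewrite /upd2; case: eqP.
- by move=> v lv; apply: eq_is_set (h3 _ lv) => // a z la; apply: E; lia.
- by move=> v d lv ld; rewrite E // h4.
- by move=> v lv; rewrite E // h5.
- by move=> v lv; rewrite E // h6.
Qed.

Lemma wp_arrow_ins n x y Q R f g :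
  below 10 x -> below 10 y -> aval R x < n -> aval R y < n ->
  implements n f g -> ~~ arrow g (aval R x) (aval R y) ->
  (forall R' f', (forall r, r < 10 -> R' r = R r) ->
    implements n f' (with_arrow g (aval R x) (aval R y) true) -> Q R' f') ->
  wp n.+1 (set_ins 1 x y) Q R f.
Proof.
move=> bx b_y lx ly I nA HQ.
apply: (wp_set_ins (S := arrow g (aval R x))); rewrite ?(ltnW lx) ?(ltnW ly) ?leqW //.
- exact: below_weaken bx.
- exact: below_weaken b_y.
- exact: imp_arrow.
move=> R' f' ER S E; apply: HQ; first by move=> r lr; apply: ER; lia.
apply: implements_with_arrow I => //; apply: eq_is_set S => // z _.
by rewrite /= /upd2 eqxx /=; case: eqP.
Qed.

Lemma wp_arrow_del n x y Q R f g :
  below 10 x -> below 10 y -> aval R x < n -> aval R y < n ->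
  implements n f g -> arrow g (aval R x) (aval R y) ->
  (forall R' f', (forall r, r < 10 -> R' r = R r) ->
    implements n f' (with_arrow g (aval R x) (aval R y) false) -> Q R' f') ->
  wp n.+1 (set_del 1 x y) Q R f.
Proof.
move=> bx b_y lx ly I nA HQ.
apply: (wp_set_del (S := arrow g (aval R x))); rewrite ?leqW //.
- exact: below_weaken bx.
- exact: below_weaken b_y.
- exact: imp_arrow.
move=> R' f' ER S E; apply: HQ; first by move=> r lr; apply: ER; lia.
apply: implements_with_arrow I => //; apply: eq_is_set S => // z _.
by rewrite /= /upd2 eqxx /=; case: eqP.
Qed.

(** * Orientations of low out-degree *)

Definition orients (n : nat) (G : graph n) (R : rel 'I_n) : Prop :=
  (forall x y, adj G x y = R x y || R y x) /\
  (forall x y, R x y -> ~~ R y x).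

Definition outdeg (n : nat) (R : rel 'I_n) (x : 'I_n) : nat := #|[set y | R x y]|.

(** One direction suffices: two orientations of the same graph that differ on an edge each have an
    arrow that the other lacks. The one-sided form makes the triangle inequality an inclusion of
    sets. *)
Definition disagreement (n : nat) (R R' : rel 'I_n) : nat :=
  #|[set p : 'I_n * 'I_n | R p.1 p.2 && ~~ R' p.1 p.2]|.

Definition set_arrow (n : nat) (R : rel 'I_n) (u v : 'I_n) (b : bool) : rel 'I_n :=
  fun x y => if (x == u) && (y == v) then b else R x y.

Definition flip (n : nat) (R : rel 'I_n) (u v : 'I_n) : rel 'I_n :=
  set_arrow (set_arrow R u v false) v u true.

Lemma set2_eq n (x y u v : 'I_n) :
  ([set x; y] == [set u; v]) = ((x == u) && (y == v)) || ((x == v) && (y == u)).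
Proof.
apply/eqP/idP => [E|/orP[/andP[/eqP-> /eqP->]|/andP[/eqP-> /eqP->]]] //; last by rewrite setUC.
have : x \in [set u; v] by rewrite -E set21.
have : y \in [set u; v] by rewrite -E set22.
have : u \in [set x; y] by rewrite E set21.
have : v \in [set x; y] by rewrite E set22.
rewrite !inE; do 4! case/orP=> /eqP ?; subst; by rewrite ?eqxx ?orbT.
Qed.

Lemma adjC n (G : graph n) x y : adj G x y = adj G y x.
Proof. by rewrite /adj eq_sym setUC. Qed.

Lemma adj_insert n (G : graph n) u v x y : u != v ->
  adj ([set u; v] |: G) x y =
  [|| (x == u) && (y == v), (x == v) && (y == u) | adj G x y].
Proof.
move=> uv; rewrite /adj !inE set2_eq.
case: (x =P y) => [->|_] /=; last by rewrite orbA.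
by case: (y =P u) => [->|_] /=; rewrite ?(negPf uv) ?andbF.
Qed.

Lemma adj_delete n (G : graph n) u v x y :
  adj (G :\ [set u; v]) x y =
  ~~ ((x == u) && (y == v) || (x == v) && (y == u)) && adj G x y.
Proof. by rewrite /adj !inE set2_eq andbCA. Qed.

Lemma orients_adj n (G : graph n) R x y : orients G R -> R x y -> adj G x y.
Proof. by case=> -> _ ->. Qed.

Lemma orients_neq n (G : graph n) R x y : orients G R -> R x y -> x != y.
Proof. by move=> o /(orients_adj o) /andP[]. Qed.

Lemma orients_flip n (G : graph n) R u v :
  orients G R -> R u v -> orients G (flip R u v).
Proof.
move=> o Ruv; have uv := orients_neq o Ruv; have [o1 o2] := o.
have nvu := o2 _ _ Ruv.
rewrite /flip /set_arrow; split=> x y.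
  rewrite o1 [(y == v) && _]andbC [(y == u) && _]andbC.
  case: (boolP ((x == u) && (y == v))) => [/andP[/eqP-> /eqP->]|nP].
    by rewrite (negPf uv) Ruv.
  by case: (boolP ((x == v) && (y == u))) => // /andP[/eqP-> /eqP->]; rewrite Ruv orbT.
rewrite [(y == v) && _]andbC [(y == u) && _]andbC.
case: (boolP ((x == v) && (y == u))) => [/andP[/eqP-> /eqP->]|nP].
  by rewrite [v == u]eq_sym (negPf uv).
by case: ifP => // _; exact: o2.
Qed.

Lemma orients_insert n (G : graph n) R u v : u != v -> [set u; v] \notin G ->
  orients G R -> orients ([set u; v] |: G) (set_arrow R u v true).
Proof.
move=> uv nG [o1 o2]; have : ~~ adj G u v by rewrite /adj uv.
rewrite o1 negb_or => /andP[nuv nvu]; rewrite /set_arrow; split=> x y.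
  rewrite adj_insert // o1 [(y == u) && _]andbC.
  case: (boolP ((x == u) && (y == v))) => [//|nP] /=.
  by case: ifP => // _; rewrite orbT.
rewrite [(y == u) && _]andbC.
case: (boolP ((x == u) && (y == v))) => [/andP[/eqP-> /eqP->]|nP].
  by rewrite (negPf uv).
by case: (boolP ((x == v) && (y == u))) => [/andP[/eqP-> /eqP->]|_]; [rewrite (negPf nvu)|exact: o2].
Qed.

Lemma orients_delete n (G : graph n) R u v : orients G R ->
  orients (G :\ [set u; v]) (set_arrow (set_arrow R u v false) v u false).
Proof.
move=> [o1 o2]; rewrite /set_arrow; split=> x y.
  rewrite adj_delete o1 [(y == u) && _]andbC [(y == v) && _]andbC.
  by case: ((x == u) && _); case: ((x == v) && _).
by do 2!case: ifP => // _; move=> /o2 r; do 2!case: ifP => // _.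
Qed.

Lemma outdeg_sub n (R R' : rel 'I_n) x :
  (forall y, R x y -> R' x y) -> outdeg R x <= outdeg R' x.
Proof. by move=> H; apply/subset_leq_card/subsetP => y; rewrite !inE; apply: H. Qed.

Lemma outdeg_set_arrow n (R : rel 'I_n) u v x :
  outdeg (set_arrow R u v true) x <= outdeg R x + (x == u).
Proof.
rewrite /outdeg /set_arrow; case: (x =P u) => /= _; last by rewrite addn0.
apply: leq_trans (_ : #|v |: [set y | R x y]| <= _); last by rewrite cardsU1 addnC leq_add2l leq_b1.
by apply/subset_leq_card/subsetP => y; rewrite !inE; case: eqP.
Qed.

Lemma outdeg_unset_arrow n (R : rel 'I_n) u v : R u v ->
  (outdeg (set_arrow R u v false) u).+1 = outdeg R u.
Proof.
move=> r; rewrite /outdeg [RHS](cardsD1 v) inE r add1n; congr (_.+1).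
by apply: eq_card => y; rewrite !inE /set_arrow eqxx /=; case: eqP.
Qed.

Lemma disagreement_triangle n (R R' R'' : rel 'I_n) :
  disagreement R R'' <= disagreement R R' + disagreement R' R''.
Proof.
apply: leq_trans (leq_card_setU _ _); apply/subset_leq_card/subsetP => p.
by rewrite !inE => /andP[-> ->]; rewrite andbT; case: (R' _ _).
Qed.

Lemma disagreement_flip n (R : rel 'I_n) u v : disagreement R (flip R u v) <= 1.
Proof.
rewrite -(cards1 (u, v)); apply/subset_leq_card/subsetP => -[x y].
rewrite !inE /flip /set_arrow xpair_eqE /=.
by case: ((x == v) && _); case: ((x == u) && _); case: (R x y).
Qed.

(** Reversing the path arrow by arrow pushes the surplus out-arrow of [u] along it to the last
    vertex, which has room for it. The summand [(p != [::])] demands this room only if something is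
    pushed; on the empty path [u] must have no surplus. *)
Lemma reorient_path n (G : graph n) d p (u : 'I_n) R : orients G R ->
  (forall x, x != u -> outdeg R x <= d) -> outdeg R u <= d.+1 ->
  path R u p -> uniq (u :: p) -> outdeg R (last u p) + (p != [::]) <= d ->
  exists R', [/\ orients G R', forall x, outdeg R' x <= d & disagreement R R' <= size p].
Proof.
elim: p u R => [|v p IH] u R o dx du.
  move=> _ _ /=; rewrite addn0 => du'; exists R; split=> //.
    by move=> x; case: (eqVneq x u) => [->|/dx].
  by rewrite /disagreement (_ : [set _ | _] = set0) ?cards0 //; apply/setP => q; rewrite !inE andbN.
move=> /= /andP[Ruv pth] /and3P[]; rewrite inE negb_or => /andP[uv up] vp Up.
rewrite addn1 => dl.
have du1 : outdeg (flip R u v) u <= d.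
  rewrite -ltnS; apply: leq_trans du; rewrite -(outdeg_unset_arrow Ruv) ltnS.
  by apply: outdeg_sub => y; rewrite /flip {1}/set_arrow (negPf uv).
have dn x : x != v -> outdeg (flip R u v) x <= outdeg R x.
  move=> xv; apply: outdeg_sub => y; rewrite /flip {1}/set_arrow (negPf xv) /= /set_arrow.
  by case: ifP.
have dv : outdeg (flip R u v) v <= (outdeg R v).+1.
  apply: leq_trans (outdeg_set_arrow _ _ _ _) _; rewrite eqxx addn1 ltnS.
  by apply: outdeg_sub => y; rewrite /set_arrow; case: ifP.
have [||||||R' [o' d' dis]] := IH v (flip R u v); first exact: orients_flip.
- move=> x xv; case: (eqVneq x u) => [->//|xu]; apply: leq_trans (dn _ xv) (dx _ xu).
- by apply: leq_trans dv _; rewrite ltnS; apply: dx; rewrite eq_sym.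
(* By [uniq] the rest of the path avoids [u], so flipping the arrow from [u] to [v] leaves its
   arrows alone. *)
- have P : all (predC1 u) (v :: p).
    by apply/allP => x xin; apply/eqP => e; move: xin; rewrite e inE (negPf uv) (negPf up).
  apply: (sub_in_path (P := predC1 u)) pth => //.
  by move=> x y /= xu yu r; rewrite /flip /set_arrow (negPf xu) (negPf yu) andbF.
- by rewrite /= vp Up.
- case: p {IH pth up} vp Up dl => [|z p] vp Up dl /=.
    by rewrite addn0; apply: leq_trans dv dl.
  rewrite addn1; apply: leq_ltn_trans dl; apply: dn.
  by apply/eqP => e; move: vp; rewrite -e mem_last.
exists R'; split=> //; apply: leq_trans (disagreement_triangle _ (flip R u v) _) _.
by rewrite -add1n leq_add // disagreement_flip.
Qed.

Fixpoint ball (n : nat) (R : rel 'I_n) (u : 'I_n) (k : nat) : {set 'I_n} :=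
  if k is k'.+1 then ball R u k' :|: [set y | [exists x in ball R u k', R x y]]
  else [set u].

Lemma ball_path n (R : rel 'I_n) u k x : x \in ball R u k ->
  exists2 p, path R u p /\ last u p = x & size p <= k.
Proof.
elim: k x => [|k IH] x /=; first by rewrite inE => /eqP->; exists [::].
rewrite !inE => /orP[/IH [p hp lp]|/exists_inP [y /IH [p [hp <-] lp] r]].
  by exists p => //; apply: leqW.
by exists (rcons p x); rewrite ?size_rcons // rcons_path last_rcons hp.
Qed.

Lemma ball_center n (R : rel 'I_n) u k : u \in ball R u k.
Proof. by elim: k => [|k IH] /=; rewrite !inE ?eqxx ?IH. Qed.

Lemma induced_edges_bound n (G : graph n) gamma (W : {set 'I_n}) :
  arboricity G <= gamma -> 1 < #|W| -> #|induced_edges G W| <= gamma * (#|W| - 1).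
Proof.
move=> ag W1; have : ceil_div #|induced_edges G W| (#|W| - 1) <= gamma.
  by apply: leq_trans ag; rewrite /arboricity (bigD1 W) //= leq_maxl.
(* With b = |W| - 1 this reads E + (b - 1) < (gamma + 1) b, which is E <= gamma b: the rounding up
   is lossless. *)
rewrite /ceil_div -ltnS ltn_divLR; last by lia.
by nia.
Qed.

(** Every arrow that leaves [V] is an edge inside [W], and an edge carries a single arrow, so the
    arrows inject into the induced edges. *)
Lemma sum_outdeg_bound n (G : graph n) R gamma (V W : {set 'I_n}) :
  orients G R -> arboricity G <= gamma -> V \subset W -> 1 < #|W| ->
  (forall x y, x \in V -> R x y -> y \in W) ->
  \sum_(x in V) outdeg R x <= gamma * (#|W| - 1).
Proof.
move=> o ag VW W1 H; apply: leq_trans (induced_edges_bound ag W1).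
pose P := [set p : 'I_n * 'I_n | (p.1 \in V) && R p.1 p.2].
have -> : \sum_(x in V) outdeg R x = #|P|.
  rewrite -sum1_card (eq_bigl (fun p : 'I_n * 'I_n => (p.1 \in V) && R p.1 p.2)); last first.
    by move=> p; rewrite inE.
  rewrite -(pair_big_dep (mem V) R (fun _ _ => 1)) /=.
  by apply: eq_bigr => x _; rewrite /outdeg -sum1_card; apply: eq_bigl => y; rewrite inE.
rewrite -(card_in_imset (f := fun p : 'I_n * 'I_n => [set p.1; p.2]) (D := P)).
  apply/subset_leq_card/subsetP => e /imsetP [[x y]]; rewrite inE /= => /andP[xV r] ->.
  rewrite inE; case/andP: (orients_adj o r) => _ -> /=.
  by rewrite subUset !sub1set (subsetP VW) // (H x).
move=> [x y] [x' y']; rewrite !inE /= => /andP[_ r] /andP[_ r'] /eqP.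
rewrite set2_eq => /orP[] /andP[/eqP ? /eqP ?]; subst => //.
by case: o => _ /(_ _ _ r); rewrite r'.
Qed.

(* A ball around u all of whose vertices have out-degree at least 2 gamma more
   than doubles in size when its radius grows by one. *)
Lemma short_path n (G : graph n) R gamma (u v : 'I_n) :
  orients G R -> arboricity G <= gamma -> R u v ->
  exists2 p, path R u p /\ uniq (u :: p)
    & size p <= trunc_log 2 n /\ outdeg R (last u p) < gamma.*2.
Proof.
move=> o ag r; set L := trunc_log 2 n.
case: (boolP [exists z in ball R u L, outdeg R z < gamma.*2]) => [/exists_inP [z zb dz]|].
  have [p [hp lp] sp] := ball_path zb.
  move: dz; rewrite -lp; case/shortenP: hp => q hq uq sq dz.
  exists q => //; split=> //; apply: leq_trans sp; apply: uniq_leq_size sq.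
  by case/andP: uq.
rewrite negb_exists_in => /forall_inP big.
have grow k : k <= L.+1 -> 2 ^ k <= #|ball R u k|.
  elim: k => [|k IH] lk; first by rewrite cards1.
  have Hk := IH (ltnW lk).
  (* All balls of radius at most [L] lie in the one where every out-degree is assumed to be at least
     [gamma.*2]. *)
  have subk : ball R u k \subset ball R u L.
    move: lk; rewrite ltnS => /subnK <-; elim: (L - k) => // m IHm.
    by apply: subset_trans IHm _; rewrite addSn /= subsetUl.
  set V := ball R u k; set W := ball R u k.+1.
  have VW : V \subset W by rewrite /W /= subsetUl.
  have out x y : x \in V -> R x y -> y \in W.
    by move=> xV rxy; rewrite /W /= !inE; apply/orP; right; apply/exists_inP; exists x.
  have uV : u \in V by apply: ball_center.
  have W1 : 1 < #|W|.
    have -> : 1 < #|W| = ((u != v).+1 <= #|W|) by rewrite (orients_neq o r).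
    rewrite -cards2; apply/subset_leq_card; rewrite subUset !sub1set (subsetP VW) //.
    by rewrite (out u).
  have := sum_outdeg_bound o ag VW W1 out.
  have : #|V| * gamma.*2 <= \sum_(x in V) outdeg R x.
    rewrite -sum_nat_const; apply: leq_sum => x xV; rewrite leqNgt.
    by apply: big; apply: (subsetP subk).
  (* The arrow from [u] to [v] makes the sum positive, hence [gamma] positive, and [gamma] can be
     cancelled in |V| 2 gamma <= gamma (|W| - 1). *)
  have : 0 < \sum_(x in V) outdeg R x.
    rewrite (bigD1 u) //= addn_gt0; apply/orP; left.
    by apply/card_gt0P; exists v; rewrite inE.
  rewrite expnS -/V in Hk *; nia.
(* At radius [L.+1] the ball would contain more than [n] vertices. *)
have := grow L.+1 (leqnn _).
have := max_card (mem (ball R u L.+1)); rewrite card_ord.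
have n0 : 0 < n by case: (n) u {r o big grow ag v} => [[]|].
have /andP[_] := trunc_log_bounds (isT : 1 < 2) n0.
by rewrite -/L => h1 h2 h3; move: (leq_trans h3 h2); rewrite leqNgt h1.
Qed.

(** Orienting the new edge away from [u] overloads at most [u], by one arrow; a short path to a
    vertex with room repairs this. *)
Lemma reorient_insert n (G : graph n) R gamma (u v : 'I_n) :
  u != v -> [set u; v] \notin G -> orients G R ->
  (forall x, outdeg R x <= gamma.*2) -> arboricity ([set u; v] |: G) <= gamma ->
  exists R', [/\ orients ([set u; v] |: G) R', forall x, outdeg R' x <= gamma.*2
    & disagreement (set_arrow R u v true) R' <= trunc_log 2 n].
Proof.
move=> uv nG o dR ag; have o' := orients_insert uv nG o.
have r : set_arrow R u v true u v by rewrite /set_arrow !eqxx.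
have [p [hp up] [sp dp]] := short_path o' ag r.
have dx x := outdeg_set_arrow R u v x.
have [|||R' [o'' d'' dis]] := reorient_path o' _ _ hp up (d := gamma.*2).
- by move=> x xu; apply: leq_trans (dx x) _; rewrite (negPf xu) addn0.
- by apply: leq_trans (dx u) _; rewrite eqxx addn1 ltnS; apply: dR.
- by move: dp; case: (p != [::]); lia.
- by exists R'; split=> //; apply: leq_trans sp.
Qed.

(** * Invariants *)

Definition arrows (n : nat) (g : dstate) : rel 'I_n := fun x y => arrow g x y.

(** The head counts the colour of the tail, so an arrow and one counter of its head always change
    together. *)
Definition add_arrow (g : dstate) (x y : nat) : dstate :=
  with_cnt (with_arrow g x y true) y (hue g x) (cnt g y (hue g x)).+1.

Definition del_arrow (g : dstate) (x y : nat) : dstate :=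
  with_cnt (with_arrow g x y false) y (hue g x) (cnt g y (hue g x)).-1.

Definition flip_arrow (g : dstate) (x y : nat) : dstate :=
  add_arrow (del_arrow g x y) y x.

(** Arrows relate natural numbers, and list entries are only known to be below [n.+1]; [ori_lt]
    turns such an entry into a vertex. *)
Record oriented (n : nat) (G : graph n) (g : dstate) : Prop := Oriented {
  ori_orients : orients G (@arrows n g);
  ori_lt : forall x y, arrow g x y -> (x < n) && (y < n);
  ori_cnt : forall v c, v < n ->
    cnt g v c = #|[set x : 'I_n | arrow g x v && (hue g x == c)]| }.

Record bounded (n : nat) (G : graph n) (b : nat) (g : dstate) : Prop := Bounded {
  bnd_deg : forall v : 'I_n, deg g v = #|[set x | adj G v x]|;
  bnd_cap : forall v : 'I_n, deg g v < cap g v <= b;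
  bnd_hue : forall v : 'I_n, 0 < hue g v <= b }.

Definition proper_hues (n : nat) (G : graph n) (g : dstate) : Prop :=
  forall x y : 'I_n, adj G x y -> hue g x <> hue g y.

Lemma eq_orients n (G : graph n) R R' : R =2 R' -> orients G R -> orients G R'.
Proof. by move=> E [o1 o2]; split=> x y; rewrite -!E; [apply: o1|apply: o2]. Qed.

Lemma arrows_add n g (x y : 'I_n) :
  @arrows n (add_arrow g x y) =2 set_arrow (@arrows n g) x y true.
Proof. by []. Qed.

Lemma cnt_le n (G : graph n) g v c : oriented G g -> v < n -> cnt g v c <= n.
Proof. by move=> o lv; rewrite (ori_cnt o) // (leq_trans (max_card _)) ?card_ord. Qed.

(** [G'] is left to the caller: it is the enlarged graph for an insertion, and the original graph
    when the second half of a flip puts an edge back. *)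
Lemma oriented_add n (G G' : graph n) g (u v : 'I_n) :
  oriented G g -> ~~ arrow g u v ->
  orients G' (set_arrow (@arrows n g) u v true) -> oriented G' (add_arrow g u v).
Proof.
move=> [_ olt oc] nA o'; split; first by apply: eq_orients o'.
- by move=> x y; rewrite /= /upd2; case: ifP => [/andP[/eqP-> /eqP->]|_ /olt //]; rewrite !ltn_ord.
move=> y c ly; rewrite /= /upd2; case: ifP => [/andP[/eqP-> /eqP->]|nyc].
  rewrite oc // [RHS](cardsD1 u) inE !eqxx /= add1n; congr (_.+1).
  apply: eq_card => x; rewrite !inE andbT.
  by rewrite -[_ == u :> nat]/(x == u); case: (eqVneq x u) => [->|ne] /=; rewrite ?(negPf nA).
rewrite oc //; apply: eq_card => x; rewrite !inE.
case: ifP => // /andP[/eqP-> /eqP ey]; move: nyc; rewrite ey eqxx /= eq_sym => ->.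
by rewrite andbF.
Qed.

Lemma cnt_gt0 n (G : graph n) g (u v : 'I_n) :
  oriented G g -> arrow g u v -> 0 < cnt g v (hue g u).
Proof. by move=> o A; rewrite (ori_cnt o) //; apply/card_gt0P; exists u; rewrite inE A /=. Qed.

Lemma oriented_del n (G G' : graph n) g (u v : 'I_n) :
  oriented G g -> arrow g u v ->
  orients G' (set_arrow (@arrows n g) u v false) -> oriented G' (del_arrow g u v).
Proof.
move=> [_ olt oc] A o'; split; first by apply: eq_orients o'.
- by move=> x y; rewrite /= /upd2; case: ifP => // _ /olt.
move=> y c ly; rewrite /= /upd2; case: ifP => [/andP[/eqP-> /eqP->]|nyc].
  rewrite oc // (cardsD1 u) inE A eqxx /=.
  apply: eq_card => x; rewrite !inE ?eqxx andbT.
  by rewrite -[_ == u :> nat]/(x == u); case: (eqVneq x u).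
rewrite oc //; apply: eq_card => x; rewrite !inE.
case: ifP => // /andP[/eqP-> /eqP ey]; move: nyc; rewrite ey eqxx /= eq_sym => ->.
by rewrite andbF.
Qed.

(** These are the arrows whose flip moves away from the reference. They enter the potential with
    weight 2: one unit pays for the flip, one for the new disagreement. *)
Definition common (n : nat) (R R' : rel 'I_n) (u : 'I_n) : nat :=
  #|[set y | R u y && R' u y]|.

Lemma orients_drop n (G : graph n) R (u v : 'I_n) : orients G R -> R u v ->
  orients (G :\ [set u; v]) (set_arrow R u v false).
Proof.
move=> o r; have nvu := o.2 _ _ r; apply: eq_orients (orients_delete u v o) => x y.
by rewrite {1}/set_arrow; case: ifP => // /andP[/eqP-> /eqP->]; rewrite /set_arrow (negPf nvu); case: ifP.
Qed.

Lemma oriented_flip n (G : graph n) g (u v : 'I_n) :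
  oriented G g -> arrow g u v -> oriented G (flip_arrow g u v).
Proof.
move=> o A; have od := orients_drop (ori_orients o) A.
have o1 : oriented (G :\ [set u; v]) (del_arrow g u v) by apply: oriented_del o A od.
apply: oriented_add o1 _ _.
  rewrite /= /upd2; case: ifP => // _.
  exact: ((ori_orients o).2 _ _ A).
exact: orients_flip (ori_orients o) A.
Qed.

(* Flipping an arrow u -> w repairs one disagreement with R, unless R also has
   u -> w. *)
Lemma flip_potential n (G : graph n) g (u w : 'I_n) (R : rel 'I_n) :
  oriented G g -> arrow g u w -> orients G R ->
  disagreement (@arrows n (flip_arrow g u w)) R
    + (common (@arrows n (flip_arrow g u w)) R u).*2 + 1
  <= disagreement (@arrows n g) R + (common (@arrows n g) R u).*2.
Proof.
move=> o A oR; have og := ori_orients o; have uw := orients_neq og (A : arrows g u w).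
have := orients_adj og (A : arrows g u w); rewrite (oR.1 u w).
set g' := flip_arrow g u w.
have E : @arrows n g' =2 flip (@arrows n g) u w by [].
case: (boolP (R u w)) => Ruw /= Rwu.
  have h1 : disagreement (@arrows n g') R <= (disagreement (@arrows n g) R).+1.
    apply: leq_trans (_ : #|(w, u) |: [set p | arrows g p.1 p.2 && ~~ R p.1 p.2]| <= _).
      apply/subset_leq_card/subsetP => -[x y]; rewrite !inE E /flip /set_arrow xpair_eqE /=.
      by case: ((x == w) && _) => //=; case: ((x == u) && _).
    by rewrite cardsU1 -add1n leq_add2r leq_b1.
  have h2 : (common (@arrows n g') R u).+1 <= common (@arrows n g) R u.
    rewrite /common [leqRHS](cardsD1 w) inE Ruw andbT [arrows g u w]A add1n ltnS.
    apply/subset_leq_card/subsetP => y; rewrite !inE E /flip /set_arrow (negPf uw) eqxx /=.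
    by case: (y == w).
  by move: h1 h2; lia.
have h1 : (disagreement (@arrows n g') R).+1 <= disagreement (@arrows n g) R.
  have uwin : (u, w) \in [set p : 'I_n * 'I_n | arrows g p.1 p.2 && ~~ R p.1 p.2].
    by rewrite inE /= Ruw andbT; exact: A.
  rewrite /disagreement [leqRHS](cardsD1 (u, w)) uwin add1n ltnS.
  apply/subset_leq_card/subsetP => -[x y]; rewrite !inE E /flip /set_arrow xpair_eqE /=.
  case: (boolP ((x == w) && (y == u))) => [/andP[/eqP-> /eqP->]|_]; first by rewrite Rwu.
  by case: ((x == u) && _).
have h2 : common (@arrows n g') R u <= common (@arrows n g) R u.
  apply/subset_leq_card/subsetP => y; rewrite !inE E /flip /set_arrow (negPf uw) eqxx /=.
  by case: (y == w).
by move: h1 h2; lia.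
Qed.

Lemma flip_outdeg n (G : graph n) g (u w : 'I_n) : oriented G g -> arrow g u w ->
  (outdeg (@arrows n (flip_arrow g u w)) u).+1 = outdeg (@arrows n g) u.
Proof.
move=> o A; rewrite -(outdeg_unset_arrow (A : arrows g u w)); congr (_.+1).
apply: eq_card => y; rewrite !inE.
rewrite -[arrows _ _ _]/(flip (@arrows n g) u w u y) /flip {1}/set_arrow.
by rewrite (negPf (orients_neq (ori_orients o) (A : arrows g u w))).
Qed.

(** If every colour of the palette were used, the counters would sum to at least [cap g u]. But each
    in-neighbour contributes to at most one counter, and without out-arrows the in-neighbours number
    [deg g u], which is less than [cap g u]. *)
Lemma exists_free_hue n (G : graph n) b g (u : 'I_n) : oriented G g -> bounded G b g ->
  (forall w : 'I_n, ~~ arrow g u w) -> exists2 c, c <= b & free_hue g u c.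
Proof.
move=> o B nA.
case: (boolP (has (fun c => cnt g u c == 0) (iota 1 (cap g u)))) => [/hasP [c]|/hasPn H].
  rewrite mem_iota add1n ltnS => /andP[c0 lc] z; exists c.
    by apply: leq_trans lc _; case/andP: (bnd_cap B u).
  by rewrite /free_hue c0 lc.
have : cap g u <= deg g u; last by have := bnd_cap B u; lia.
rewrite (bnd_deg B).
apply: leq_trans (_ : \sum_(c <- iota 1 (cap g u)) cnt g u c <= _).
  rewrite -{1}(size_iota 1 (cap g u)) -sum1_size big_seq [leqRHS]big_seq.
  by apply: leq_sum => c /H; rewrite lt0n.
rewrite (eq_bigr (fun c => \sum_(x : 'I_n | arrow g x u) (hue g x == c))); last first.
  by move=> c _; rewrite (ori_cnt o) // -sum1dep_card big_mkcondr /=; apply: eq_bigr => x _; case: eqP.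
rewrite exchange_big /= -sum1_card.
rewrite [leqRHS](eq_bigl (fun x : 'I_n => arrow g x u)); last first.
  by move=> x; rewrite inE (ori_orients o).1 /arrows (negPf (nA x)).
apply: leq_sum => x _.
rewrite (eq_bigr (fun c => if c == hue g x then 1 else 0)); last first.
  by move=> c _; rewrite eq_sym; case: eqP.
by rewrite -big_mkcond sum1_count (count_uniq_mem _ (iota_uniq _ _)) leq_b1.
Qed.

(** * The update procedures *)

(* Arguments u, v in registers 0 and 1.  Register 2: the colour of u;
   register 5: whether u and v have the same colour; register 6: the number
   of arrows out of u that remain to be flipped. *)
Definition insert_pre : ins :=
  (grow (Rg 0) ;;
   grow (Rg 1) ;;
   set_ins 1 (Rg 0) (Rg 1) ;;
   ILd 2 0 (Lit 0) (Rg 0) ;;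
   incr_cnt (Rg 1) (Rg 2) ;;
   ILd 3 0 (Lit 0) (Rg 1) ;;
   IOp 5 OpEq (Rg 2) (Rg 3) ;;
   IIf (Rg 5) (ILd 6 3 (Rg 0) (Lit 0)) (IOp 6 OpAdd (Lit 0) (Lit 0)))%ins.

(** The last listed out-neighbour is taken. It forgets the colour of [u], and [u] starts to count
    its colour; register 6 is then reloaded from the size cell. *)
Definition flip_body : ins :=
  (IOp 6 OpSub (Rg 6) (Lit 1) ;;
   ILd 4 1 (Rg 0) (Rg 6) ;;
   set_del 1 (Rg 0) (Rg 4) ;;
   decr_cnt (Rg 4) (Rg 2) ;;
   set_ins 1 (Rg 4) (Rg 0) ;;
   ILd 3 0 (Lit 0) (Rg 4) ;;
   incr_cnt (Rg 0) (Rg 3) ;;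
   ILd 6 3 (Rg 0) (Lit 0))%ins.

(** Any listed free colour would do, and entry 0 is the cheapest to find. No counter is touched,
    since no arrow leaves [u] at this moment. *)
Definition insert_post : ins :=
  IIf (Rg 5)
    (ILd 3 4 (Rg 0) (Lit 0) ;; ISt 0 (Lit 0) (Rg 0) (Rg 3))%ins ISkip.

(** Position 0 in array 2 means that the arrow runs from [v] to [u]; then registers 0 and 1 are
    swapped, so that the remaining code always sees an arrow from register 0 to register 1. *)
Definition delete_ins : ins :=
  (ILd 2 2 (Rg 0) (Rg 1) ;;
   IIf (Rg 2) ISkip
     (IOp 2 OpAdd (Rg 0) (Lit 0) ;;
      IOp 0 OpAdd (Rg 1) (Lit 0) ;;
      IOp 1 OpAdd (Rg 2) (Lit 0)) ;;
   set_del 1 (Rg 0) (Rg 1) ;;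
   ILd 2 0 (Lit 0) (Rg 0) ;;
   decr_cnt (Rg 1) (Rg 2) ;;
   shrink (Rg 0) ;;
   shrink (Rg 1))%ins.

Definition query_ins : ins := ILd 0 0 (Lit 0) (Rg 0).

Lemma wp_flip_body n (G : graph n) b g (u : 'I_n) Q (R : nat -> nat) f :
  b <= n -> implements n f g -> oriented G g -> bounded G b g ->
  R 0 = u :> nat -> R 2 = hue g u -> R 6 = f 3 u 0 -> R 6 <> 0 ->
  (forall R' f' (w : 'I_n), arrow g u w -> implements n f' (flip_arrow g u w) ->
    R' 0 = u :> nat -> R' 2 = hue g u -> R' 5 = R 5 -> R' 6 = f' 3 u 0 -> Q R' f') ->
  wp n.+1 flip_body Q R f.
Proof.
move=> bn I o B R0 R2 R6 R6n HQ.
have IA := imp_arrow I (ltn_ord u); have lN := is_set_size IA.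
have hue_n (v : 'I_n) : 0 < hue g v <= n by have := bnd_hue B v; lia.
apply/wp_seq/wp_op; [by rewrite /= R6|by []|by rewrite /= R6; lia|].
rewrite [eval_op _ _ _]/=; set R1 := upd _ _ _.
have lt6 : R 6 - 1 < f 3 u 0 by lia.
have [l1 l2 l3] := is_set_arr IA lt6.
have /andP[_ lw] := ori_lt o l2.
have A1 : (R1 0 = u) * (R1 6 = R 6 - 1) by rewrite /R1 /upd /= R0.
have lu : u < n.+1 by apply: leqW.
apply/wp_seq/wp_ld; rewrite /aval ?A1; [by []|exact: leq_trans lt6 lN|].
pose w : 'I_n := Ordinal lw; rewrite -[f 1 u _]/(nat_of_ord w).
set R2' := upd _ _ _.
have A2 : (R2' 0 = u) * (R2' 2 = hue g u) * (R2' 4 = w) *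
          (R2' 5 = R 5) by rewrite /R2' /R1 /upd /= R0 R2.
have uw : arrow g u w := l2.
have od := orients_drop (ori_orients o) (uw : arrows g u w).
have o1 := oriented_del o uw od.
apply/wp_seq/(wp_arrow_del (g := g)); rewrite /aval ?A2 //.
move=> R3 f3 L3 I3.
have A3 : (R3 0 = u) * (R3 2 = hue g u) * (R3 4 = w) *
          (R3 5 = R 5) by rewrite !L3 //; exact: A2.
apply/wp_seq/(wp_decr_cnt _ _ _ _ I3); rewrite /aval ?A3 //.
- by rewrite (cnt_gt0 o uw) (cnt_le _ o).
- by have := bnd_cap B w; rewrite /=; lia.
move=> R4 f4 L4 I4.
have A4 : (R4 0 = u) * (R4 4 = w) * (R4 2 = hue g u) *
          (R4 5 = R 5) by rewrite !L4 // !A3.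
apply/wp_seq/(wp_arrow_ins _ _ _ _ I4); rewrite /aval ?A4 //.
  by rewrite /= /upd2; case: ifP => // _; exact: (ori_orients o).2 _ _ uw.
move=> R5 f5 L5 I5.
have A5 : (R5 0 = u) * (R5 4 = w) * (R5 2 = hue g u) *
          (R5 5 = R 5) by rewrite !L5 // !A4.
apply/wp_seq/wp_ld; rewrite /aval ?A5 //.
rewrite [f5 _ _ _](imp_hue I5) //; set R6' := upd _ _ _.
have A6 : (R6' 0 = u) * (R6' 3 = hue g w) * (R6' 2 = hue g u) *
          (R6' 5 = R 5) by rewrite /R6' /upd /= !A5.
apply/wp_seq/(wp_incr_cnt _ _ _ _ I5); rewrite /aval ?A6 //.
- by case/andP: (hue_n w).
- exact: (cnt_le _ o1).
move=> R7 f7 L7 I7.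
have A7 : (R7 0 = u) * (R7 2 = hue g u) *
          (R7 5 = R 5) by rewrite !L7 // !A6.
apply: wp_ld; rewrite /aval ?A7 //.
by apply: (HQ _ _ w) => //; rewrite /upd /= ?A7.
Qed.

(** Each flip lowers the out-degree of [u], which [k] bounds, and lowers disagreement plus twice
    [common] by at least one; telescoping gives the last clause. [R] is quantified after the run, so
    the reference can be chosen later. The summand 2 per iteration is the cost of the guard. *)
Lemma flip_loop n (G : graph n) b (u : 'I_n) w :
  b <= n -> num_arrays * n.+1 * n.+1 <= 2 ^ w -> n.+1 < 2 ^ w ->
  forall k g s f, outdeg (@arrows n g) u <= k ->
  represents w n.+1 s f -> implements n f g -> oriented G g -> bounded G b g ->
  regs s 0 = u :> nat -> regs s 2 = hue g u -> regs s 6 = f 3 u 0 ->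
  exists t s' f' g' m,
    [/\ exec w (While (Reg 6) (compile flip_body)) s t s',
        represents w n.+1 s' f', implements n f' g' & oriented G g'] /\
    [/\ bounded G b g', hue g' = hue g, regs s' 0 = u :> nat & regs s' 5 = regs s 5] /\
    [/\ forall x : 'I_n, ~~ arrow g' u x,
        t <= m * (time_bound flip_body + 2) + 2
      & forall R, orients G R ->
          disagreement (@arrows n g') R + m <=
          disagreement (@arrows n g) R + (common (@arrows n g) R u).*2].
Proof.
move=> bn hw hN; elim=> [|k IH] g s f dk rep I o B R0 R2 R6;
  have IA := imp_arrow I (ltn_ord u); have lN := is_set_size IA;
  have ev : eval w s (Reg 6) = f 3 u 0 by
    [rewrite /= R6 modn_small // (leq_ltn_trans lN)];
  case: (eqVneq (f 3 u 0) 0) => len.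
- exists 2, s, f, g, 0; split; first by split=> //; apply: ExecWhileFalse; rewrite ev.
  split=> //; split=> //; last by move=> R _; lia.
  by move=> x; apply/negP => ux; have := is_set_neq0 IA (ltnW (ltn_ord x)) ux; rewrite len.
- have l0 : 0 < f 3 u 0 by rewrite lt0n.
  have [_ l2 _] := is_set_arr IA l0; have /andP[_ lw] := ori_lt o l2.
  have : 0 < outdeg (@arrows n g) u by apply/card_gt0P; exists (Ordinal lw); rewrite inE.
  by move: dk; lia.
- exists 2, s, f, g, 0; split; first by split=> //; apply: ExecWhileFalse; rewrite ev.
  split=> //; split=> //; last by move=> R _; lia.
  by move=> x; apply/negP => ux; have := is_set_neq0 IA (ltnW (ltn_ord x)) ux; rewrite len.
have H : wp n.+1 flip_body (fun R' f' => exists x : 'I_n, [/\ arrow g u x,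
    implements n f' (flip_arrow g u x) & [/\ R' 0 = u :> nat, R' 2 = hue g u, R' 5 = regs s 5
    & R' 6 = f' 3 u 0]]) (regs s) f.
  have R6n : regs s 6 <> 0 by rewrite R6; apply/eqP.
  apply: (wp_flip_body bn I o B R0 R2 R6 R6n).
  by move=> R' f' x; exists x.
have [t1 [s1 [f1 [e1 b1 rep1 [x [ux I1 [R10 R12 R15 R16]]]]]]] :=
  wp_exec (i := flip_body) hw hN isT rep H.
have o1 := oriented_flip o ux; have d1 := flip_outdeg o ux.
have [||t2 [s2 [f2 [g2 [m [[e2 rep2 I2 o2] [[B2 h2 R20 R25] [nA ht pot]]]]]]]] :=
  IH (flip_arrow g u x) s1 f1 _ rep1 I1 o1 _ R10 R12 R16.
- by move: dk; rewrite -d1.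
- by case: B => B1 B2 B3; split.
exists (2 + t1 + t2), s2, f2, g2, m.+1; split; first split=> //.
  by apply: ExecWhileTrue e1 e2; rewrite ev; apply/eqP.
split; first by split=> //; rewrite R25.
split=> //; first by move: ht b1; lia.
by move=> R oR; have := pot _ oR; have := flip_potential o ux oR; lia.
Qed.

(** * Correctness of insertion *)

Lemma card_adj_insert n (G : graph n) (u v x : 'I_n) : u != v -> [set u; v] \notin G ->
  #|[set y | adj ([set u; v] |: G) x y]| = #|[set y | adj G x y]| + (x == u) + (x == v).
Proof.
move=> uv nG; have nA : adj G u v = false by rewrite /adj (negPf nG) andbF.
case: (eqVneq x u) => [->|xu].
  rewrite (negPf uv) addn0 (cardsD1 v) inE adj_insert // !eqxx /= addnC; congr (_ + _).
  apply: eq_card => y; rewrite !inE adj_insert // eqxx (negPf uv) /=.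
  by case: (eqVneq y v) => // ->.
case: (eqVneq x v) => [->|xv].
  rewrite addn0 (cardsD1 u) inE adj_insert // !eqxx /= orbT addnC; congr (_ + _).
  apply: eq_card => y; rewrite !inE adj_insert // eqxx [v == u]eq_sym (negPf uv) /=.
  by case: (eqVneq y u) => // ->; rewrite adjC.
by rewrite !addn0; apply: eq_card => y; rewrite !inE adj_insert // (negPf xu) (negPf xv).
Qed.

Lemma grown_deg g x : deg (grown g x) = upd (deg g) x (deg g x).+1.
Proof. by rewrite /grown; case: ifP. Qed.

Lemma grown_cap g x y : cap (grown g x) y =
  if (y == x) && ((deg g x).+1 == cap g x) then (deg g x).+2 else cap g y.
Proof. by rewrite /grown andbC; case: ifP => _ //=; rewrite /upd. Qed.

Lemma grown_hue g x : hue (grown g x) = hue g.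
Proof. by rewrite /grown; case: ifP. Qed.

Lemma grown_cnt g x : cnt (grown g x) = cnt g.
Proof. by rewrite /grown; case: ifP. Qed.

Lemma grown_arrow g x : arrow (grown g x) = arrow g.
Proof. by rewrite /grown; case: ifP. Qed.

Lemma oriented_grown n (G : graph n) g x : oriented G g -> oriented G (grown g x).
Proof.
by case=> h1 h2 h3; split=> [|y z|v c lv]; rewrite /arrows ?grown_hue ?grown_arrow ?grown_cnt //;
   [exact: h2|exact: h3].
Qed.

Lemma wp_insert_pre n (G : graph n) b b' g (u v : 'I_n) Q (R : nat -> nat) f :
  u != v -> [set u; v] \notin G -> b <= b' -> b' <= n ->
  (forall x, #|[set y | adj ([set u; v] |: G) x y]| < b') ->
  implements n f g -> oriented G g -> bounded G b g ->
  R 0 = u :> nat -> R 1 = v :> nat ->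
  (forall R' f' g', implements n f' g' -> oriented ([set u; v] |: G) g' ->
    bounded ([set u; v] |: G) b' g' -> hue g' = hue g ->
    @arrows n g' =2 set_arrow (@arrows n g) u v true ->
    R' 0 = u :> nat -> R' 2 = hue g u -> R' 5 = (hue g u == hue g v) ->
    R' 6 = (if hue g u == hue g v then f' 3 u 0 else 0) -> Q R' f') ->
  wp n.+1 insert_pre Q R f.
Proof.
move=> uv nG bb bn db I o B R0 R1 HQ.
have ca x := card_adj_insert x uv nG.
have du : (deg g u).+1 < b' by have := db u; rewrite ca eqxx (negPf uv) -(bnd_deg B); lia.
have dv : (deg g v).+1 < b'.
  by have := db v; rewrite ca eqxx eq_sym (negPf uv) -(bnd_deg B); lia.
have hue_n (x : 'I_n) : 0 < hue g x <= n by have := bnd_hue B x; lia.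
have lu : u < n.+1 by apply: leqW.
have lv : v < n.+1 by apply: leqW.
have vu : (v == u :> nat) = false by apply/negbTE; rewrite eq_sym.
apply/wp_seq/(wp_grow _ _ I); rewrite /aval ?R0 //.
- by have := bnd_cap B u; lia.
- by lia.
- by move=> c; apply: cnt_le o _.
move=> Ra fa La Ia.
apply/wp_seq/(wp_grow _ _ Ia); rewrite /aval ?La // ?R1 //.
- by rewrite grown_deg grown_cap /upd vu /=; have := bnd_cap B v; lia.
- by rewrite grown_deg /upd vu /=; lia.
- by move=> c; rewrite grown_cnt; apply: cnt_le o _.
set g2 := grown (grown g u) v; have o2 : oriented G g2 by do 2!apply: oriented_grown.
have g2h : hue g2 = hue g by rewrite /g2 !grown_hue.
have g2a : arrow g2 = arrow g by rewrite /g2 !grown_arrow.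
have nuv : ~~ arrow g2 u v.
  have : ~~ adj G u v by rewrite /adj (negPf nG) andbF.
  by rewrite (ori_orients o2).1 negb_or => /andP[].
move=> Rb fb Lb Ib.
have Ab : (Rb 0 = u) * (Rb 1 = v) by rewrite !Lb // !La.
apply/wp_seq/(wp_arrow_ins _ _ _ _ Ib); rewrite /aval ?Ab //.
move=> Rc fc Lc Ic; have Ac : (Rc 0 = u) * (Rc 1 = v) by rewrite !Lc // !Ab.
apply/wp_seq/wp_ld; rewrite /aval ?Ac //.
rewrite [fc _ _ _](imp_hue Ic) // [hue _]g2h; set Rd := upd _ _ _.
have Ad : (Rd 0 = u) * (Rd 1 = v) * (Rd 2 = hue g u) by rewrite /Rd /upd /= !Ac.
apply/wp_seq/(wp_incr_cnt _ _ _ _ Ic); rewrite /aval ?Ad //.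
- by case/andP: (hue_n u).
- exact: (cnt_le _ o2).
move=> Re fe Le; rewrite -g2h => Ie.
have Ae : (Re 0 = u) * (Re 1 = v) * (Re 2 = hue g u) by rewrite !Le // !Ad.
apply/wp_seq/wp_ld; rewrite /aval ?Ae //.
rewrite [fe _ _ _](imp_hue Ie) // [hue _]g2h; set Rf := upd _ _ _.
have Af : (Rf 0 = u) * (Rf 1 = v) * (Rf 2 = hue g u) * (Rf 3 = hue g v).
  by rewrite /Rf /upd /= !Ae.
apply/wp_seq/wp_op; rewrite /aval ?Af //.
- by have := hue_n u; lia.
- by have := hue_n v; lia.
- by rewrite /=; lia.
rewrite [eval_op _ _ _]/=; set Rh := upd _ _ _.
have Ah : (Rh 0 = u) * (Rh 2 = hue g u) * (Rh 5 = (hue g u == hue g v)) by rewrite /Rh /upd /= !Af.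
have o' := orients_insert uv nG (ori_orients o2).
have og' : oriented ([set u; v] |: G) (add_arrow g2 u v) by apply: oriented_add o2 nuv o'.
have Bg' : bounded ([set u; v] |: G) b' (add_arrow g2 u v).
  have dE (x : 'I_n) : deg g2 x = #|[set y | adj ([set u; v] |: G) x y]|.
    rewrite ca -(bnd_deg B) /g2 grown_deg /upd grown_deg /upd vu.
    rewrite -[_ == _ :> nat]/(x == v) -[_ == u :> nat]/(x == u).
    case: (eqVneq x v) => [->|xv] /=; first by rewrite eq_sym (negPf uv) addn0 addn1.
    by case: (eqVneq x u) => [->|xu] /=; rewrite ?addn0 ?addn1.
  split=> x /=; first exact: dE.
    have := db x; rewrite -dE => lx; move: lx.
    rewrite /g2 !grown_cap !grown_deg /upd vu /=.
    have := bnd_cap B x; have := bnd_cap B u; have := bnd_cap B v.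
    by case: (nat_of_ord x =P v) => [->|] /=; rewrite ?vu /=; [|case: (nat_of_ord x =P u) => [->|] /=]; do ?case: ifP; lia.
  by rewrite g2h; have := bnd_hue B x; lia.
have arr : @arrows n (add_arrow g2 u v) =2 set_arrow (@arrows n g) u v true.
  by move=> x y; rewrite arrows_add /set_arrow /arrows g2a.
apply: wp_if; rewrite /aval ?Ah.
- by lia.
- move=> E; apply: wp_op => //.
  apply: (HQ _ _ (add_arrow g2 u v)) => //; rewrite /upd /= ?Ah //.
  by case: (hue g u == hue g v) E.
move=> E; apply: wp_ld; rewrite /aval ?Ah //.
apply: (HQ _ _ (add_arrow g2 u v)) => //; rewrite /upd /= ?Ah //.
by case: (hue g u == hue g v) E.
Qed.

Lemma implements_with_hue n f g x c :
  implements n f g -> implements n (write f 0 0 x c) (with_hue g x c).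
Proof.
case=> h1 h2 h3 h4 h5 h6; split=> //=.
- by move=> v lv; rewrite /write /upd /=; case: eqP => // _; exact: h1.
- by move=> v lv; apply: eq_is_set (h2 _ lv) => // a y la; solve_write.
- by move=> v lv; apply: eq_is_set (h3 _ lv) => // a y la; solve_write.
Qed.

Lemma oriented_with_hue n (G : graph n) g (u : 'I_n) c :
  oriented G g -> (forall x : 'I_n, ~~ arrow g u x) -> oriented G (with_hue g u c).
Proof.
move=> [o1 o2 o3] nA; split=> // v d lv; rewrite /= o3 //.
apply: eq_card => x; rewrite !inE /upd; case: (nat_of_ord x =P u) => // ->.
by rewrite (negPf (nA (Ordinal lv))).
Qed.

(** All neighbours of [u] are in-neighbours, so a zero counter for [c] excludes [c] among them.
    Properness is assumed only away from [u], because the inserted edge is still monochromatic when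
    this is applied. *)
Lemma proper_with_free_hue n (G : graph n) g (u : 'I_n) c :
  oriented G g -> (forall x : 'I_n, ~~ arrow g u x) -> free_hue g u c ->
  (forall x y : 'I_n, x != u -> y != u -> adj G x y -> hue g x <> hue g y) ->
  proper_hues G (with_hue g u c).
Proof.
move=> o nA /andP[_ /eqP c0] prop.
have nu (y : 'I_n) : adj G u y -> hue g y <> c.
  rewrite (ori_orients o).1 /arrows (negPf (nA y)) /= => yu E.
  by have := cnt_gt0 o yu; rewrite E c0.
move=> x y a; rewrite /= /upd.
rewrite -[_ == u :> nat]/(x == u) -[y == u :> nat]/(y == u).
case: (eqVneq x u) => [ex|xu]; case: (eqVneq y u) => [ey|yu].
- by move: a; rewrite ex ey /adj eqxx.
- by rewrite ex in a; move=> E; apply: (nu y a).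
- by rewrite ey adjC in a; apply: (nu x a).
- exact: prop.
Qed.

(** The loop needs no surrounding test: if the colours differ, [insert_pre] leaves 0 in register 6
    and the guard fails at once. *)
Definition insert_cmd : cmd :=
  Seq (compile insert_pre)
    (Seq (While (Reg 6) (compile flip_body)) (compile insert_post)).

Lemma insert_correct n (G : graph n) b b' g (u v : 'I_n) w s f :
  num_arrays * n.+1 * n.+1 <= 2 ^ w -> n.+1 < 2 ^ w ->
  u != v -> [set u; v] \notin G -> b <= b' -> b' <= n ->
  (forall x, #|[set y | adj ([set u; v] |: G) x y]| < b') ->
  represents w n.+1 s f -> implements n f g -> oriented G g -> bounded G b g ->
  proper_hues G g -> regs s 0 = u :> nat -> regs s 1 = v :> nat ->
  exists t s' f' g' m,
    [/\ exec w insert_cmd s t s', represents w n.+1 s' f', implements n f' g'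
      & t <= time_bound insert_pre + time_bound insert_post + 2
             + m * (time_bound flip_body + 2)] /\
    [/\ oriented ([set u; v] |: G) g', bounded ([set u; v] |: G) b' g',
        proper_hues ([set u; v] |: G) g'
      & forall x : 'I_n, x != u -> hue g' x = hue g x] /\
    forall R, orients ([set u; v] |: G) R ->
      disagreement (@arrows n g') R + m <=
      disagreement (set_arrow (@arrows n g) u v true) R + (outdeg R u).*2.
Proof.
move=> hw hN uv nG bb bn db rep I o B P R0 R1.
have H : wp n.+1 insert_pre (fun R' f' => exists g', [/\ implements n f' g',
    oriented ([set u; v] |: G) g', bounded ([set u; v] |: G) b' g' & hue g' = hue g] /\
    [/\ @arrows n g' =2 set_arrow (@arrows n g) u v true,
    R' 0 = u :> nat, R' 2 = hue g u, R' 5 = (hue g u == hue g v)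
    & R' 6 = (if hue g u == hue g v then f' 3 u 0 else 0)]) (regs s) f.
  apply: (wp_insert_pre uv nG bb bn db I o B R0 R1).
  by move=> R' f' g' *; exists g'.
have [t1 [s1 [f1 [e1 b1 rep1 [g1 [[I1 o1 B1 h1] [arr R10 R12 R15 R16]]]]]]] :=
  wp_exec (i := insert_pre) hw hN isT rep H.
have comm R : common (@arrows n g1) R u <= outdeg R u.
  by apply/subset_leq_card/subsetP => y; rewrite !inE => /andP[].
have disE R : disagreement (@arrows n g1) R = disagreement (set_arrow (@arrows n g) u v true) R.
  by apply: eq_card => p; rewrite !inE arr.
case: (eqVneq (hue g u) (hue g v)) => [huv|huv]; last first.
  rewrite (negPf huv) in R15 R16.
  have H2 : wp n.+1 insert_post (fun R' f' => f' = f1) (regs s1) f1 by split; rewrite /= R15.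
  have [t2 [s2 [f2 [e2 b2 rep2 Ef]]]] := wp_exec (i := insert_post) hw hN isT rep1 H2.
  rewrite {}Ef in rep2.
  exists (t1 + (2 + t2)), s2, f1, g1, 0; split; first split=> //.
  - apply: ExecSeq e1 _; apply: ExecSeq e2; apply: ExecWhileFalse.
    by rewrite /= R16 mod0n.
  - by lia.
  split; last by move=> R oR; rewrite disE; lia.
  split=> //; last by rewrite h1.
  move=> x y; rewrite adj_insert // h1 => /or3P[/andP[/eqP-> /eqP->]|/andP[/eqP-> /eqP->]|/P //].
    exact/eqP.
  by apply/eqP; rewrite eq_sym.
rewrite huv eqxx in R15 R16; rewrite -h1 in R12.
have [t2 [s2 [f2 [g2 [m [[e2 rep2 I2 o2] [[B2 h2 R20 R25] [nA ht pot]]]]]]]] :=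
  flip_loop bn hw hN (leqnn _) rep1 I1 o1 B1 R10 R12 R16.
(* The colour [c] only shows that the list of free colours is nonempty; the colour assigned is its
   first entry [c']. *)
have [c cb fc] := exists_free_hue o2 B2 nA.
have IS := imp_free I2 (ltn_ord u).
have cn : c < n.+1 by rewrite ltnS; apply: leq_trans bn.
have len := is_set_neq0 IS cn fc.
have [l1 l2 _] := is_set_arr IS len; set c' := f2 4 u 0 in l1 l2.
have H3 : wp n.+1 insert_post (fun R' f' => f' = write f2 0 0 u c') (regs s2) f2.
  split; rewrite /= R25 R15 //= /upd /= R20; split=> //; first exact: leqW.
  by split=> //; [exact: leqW|exact: ltnW].
have [t3 [s3 [f3 [e3 b3 rep3 Ef]]]] := wp_exec (i := insert_post) hw hN isT rep2 H3.
have c'b : 0 < c' <= b'.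
  by case/andP: l2 => /andP[-> lc] _ /=; apply: leq_trans lc _; case/andP: (bnd_cap B2 u).
exists (t1 + (t2 + t3)), s3, f3, (with_hue g2 u c'), m; split; first split=> //.
- by apply: ExecSeq e1 _; apply: ExecSeq e2 e3.
- by rewrite Ef; apply: implements_with_hue.
- by move: ht b1 b3; lia.
split.
  split.
  - exact: oriented_with_hue.
  - by case: B2 => B21 B22 B23; split=> // x; rewrite /= /upd; case: eqP.
  - apply: proper_with_free_hue => // x y xu yu; rewrite h2 h1 adj_insert //.
    by rewrite (negPf xu) (negPf yu) andbF /=; exact: P.
  - by move=> x xu; rewrite /= /upd ifF ?h2 ?h1 //; apply/negbTE.
move=> R oR; have := pot R oR; rewrite disE; have := comm R.
by rewrite -[disagreement (@arrows n (with_hue _ _ _)) _]/(disagreement (@arrows n g2) R); lia.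
Qed.

(** * Correctness of deletion *)

Lemma delete_correct n (G : graph n) b g (u v : 'I_n) w s f :
  num_arrays * n.+1 * n.+1 <= 2 ^ w -> n.+1 < 2 ^ w ->
  u != v -> [set u; v] \in G -> b <= n ->
  represents w n.+1 s f -> implements n f g -> oriented G g -> bounded G b g ->
  proper_hues G g -> regs s 0 = u :> nat -> regs s 1 = v :> nat ->
  exists t s' f' g',
    [/\ exec w (compile delete_ins) s t s', represents w n.+1 s' f', implements n f' g'
      & t <= time_bound delete_ins] /\
    [/\ oriented (G :\ [set u; v]) g', bounded (G :\ [set u; v]) b g',
        proper_hues (G :\ [set u; v]) g' & hue g' = hue g] /\
    @arrows n g' =2 set_arrow (set_arrow (@arrows n g) u v false) v u false.
Proof.
move=> hw hN uv inG bn rep I o B P R0 R1.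
have a : adj G u v by rewrite /adj uv.
(* The deletion is read as an insertion undone, so the degree count for insertions applies to the
   smaller graph. *)
have ca (x : 'I_n) : deg g x = #|[set y | adj (G :\ [set u; v]) x y]| + (x == u) + (x == v).
  rewrite (bnd_deg B) -card_adj_insert ?setD1K //; by rewrite !inE eqxx.
have hue_n (x : 'I_n) : 0 < hue g x <= n by have := bnd_hue B x; lia.
have lu : u < n.+1 by apply: leqW.
have lv : v < n.+1 by apply: leqW.
pose Q := fun (_ : nat -> nat) f' => exists2 g', implements n f' g' &
    [/\ oriented (G :\ [set u; v]) g', bounded (G :\ [set u; v]) b g',
        proper_hues (G :\ [set u; v]) g' & hue g' = hue g] /\
    @arrows n g' =2 set_arrow (set_arrow (@arrows n g) u v false) v u false.
suff H : wp n.+1 delete_ins Q (regs s) f.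
  have [t [s' [f' [e lt rep' [g' I' [h1 h2]]]]]] := wp_exec (i := delete_ins) hw hN isT rep H.
  by exists t, s', f', g'.
(* Stated for either naming of the endpoints, since the arrow may run from [u] to [v] or back. *)
have tail (x y : 'I_n) (R : nat -> nat) : [set x; y] = [set u; v] -> arrow g x y ->
    R 0 = x :> nat -> R 1 = y :> nat ->
    wp n.+1 (set_del 1 (Rg 0) (Rg 1) ;; ILd 2 0 (Lit 0) (Rg 0) ;;
      decr_cnt (Rg 1) (Rg 2) ;; shrink (Rg 0) ;; shrink (Rg 1))%ins Q R f.
  move=> Exy xy Rx Ry; have nyx := (ori_orients o).2 _ _ xy.
  have xny := orients_neq (ori_orients o) (xy : arrows g x y).
  have yx : (y == x :> nat) = false by apply/negbTE; rewrite eq_sym.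
  have lx : x < n.+1 by apply: leqW.
  have ly : y < n.+1 by apply: leqW.
  have o1 : oriented (G :\ [set u; v]) (del_arrow g x y).
    by apply: (oriented_del o xy); rewrite -Exy; apply: orients_drop (ori_orients o) xy.
  have dn (z : 'I_n) : deg g z <= n by have := bnd_cap B z; lia.
  apply/wp_seq/(wp_arrow_del (g := g)); rewrite /aval ?Rx ?Ry //.
  move=> Ra fa La Ia; have Aa : (Ra 0 = x) * (Ra 1 = y) by rewrite !La // Rx.
  apply/wp_seq/wp_ld; rewrite /aval ?Aa //.
  rewrite [fa _ _ _](imp_hue Ia) //; set Rb := upd _ _ _.
  have Ab : (Rb 0 = x) * (Rb 1 = y) * (Rb 2 = hue g x) by rewrite /Rb /upd /= !Aa.
  apply/wp_seq/(wp_decr_cnt _ _ _ _ Ia); rewrite /aval ?Ab //.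
  - by rewrite (cnt_gt0 o xy) (cnt_le _ o).
  - by have := bnd_cap B y; rewrite /=; lia.
  move=> Rc fc Lc Ic; have Ac : (Rc 0 = x) * (Rc 1 = y) by rewrite !Lc // !Ab.
  apply/wp_seq/(wp_shrink _ _ Ic); rewrite /aval ?Ac //.
    exact: dn.
  move=> Rd fd Ld Id; have Ad : (Rd 0 = x) * (Rd 1 = y) by rewrite !Ld // !Ac.
  apply: (wp_shrink _ _ Id); rewrite /aval ?Ad //.
    by rewrite /= /upd yx; exact: dn.
  move=> Re fe Le Ie; eexists; first exact: Ie.
  split.
    split=> //.
    - by case: o1 => q1 q2 q3; split.
    - have dE (z : 'I_n) : upd (upd (deg g) x (deg g x).-1) y
          (upd (deg g) x (deg g x).-1 y).-1 z = #|[set t | adj (G :\ [set u; v]) z t]|.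
        have E2 : (z == u) + (z == v) = (z == x) + (z == y).
          have /eqP := Exy; rewrite set2_eq => /orP[] /andP[/eqP-> /eqP->] //.
          by rewrite addnC.
        have := ca z; rewrite -addnA E2 /upd yx.
        rewrite -[_ == y :> nat]/(z == y) -[_ == x :> nat]/(z == x).
        case: (eqVneq z y) => [->|zy]; first by rewrite [y == x]yx; clear; lia.
        by case: (eqVneq z x) => [->|zx]; clear; lia.
      split=> z; first exact: dE.
        have := dE z; rewrite [deg _ z]/= [cap _ z]/= => ->.
        by have := bnd_cap B z; have := ca z; clear; lia.
      exact: (bnd_hue B z).
    - by move=> z t; rewrite adj_delete => /andP[_ /P].
  move=> z t; rewrite -[arrows _ z t]/(set_arrow (@arrows n g) x y false z t).
  have /eqP := Exy; rewrite set2_eq => /orP[] /andP[/eqP ex /eqP ey]; rewrite -ex -ey.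
    rewrite /set_arrow; case: (boolP ((z == y) && (t == x))) => // /andP[/eqP-> /eqP->].
    by case: ifP => // _; apply/negbTE.
  rewrite /set_arrow; case: ifP => // _; case: ifP => // /andP[/eqP-> /eqP->].
  exact/negbTE.
have IS := imp_arrow I (ltn_ord u).
apply/wp_seq/wp_ld; rewrite /aval ?R0 ?R1 //.
set Ra := upd _ _ _; have Aa : (Ra 0 = u) * (Ra 1 = v) * (Ra 2 = f 2 u v).
  by rewrite /Ra /upd /= R0 R1.
apply/wp_seq/wp_if; rewrite /aval ?Aa.
- case: (boolP (arrow g u v)) => A; last by rewrite (is_set_pos0 IS).
  by have [/andP[_ h] _] := is_set_pos IS lv A; apply: leq_trans h (is_set_size IS).
- move=> z; have nuv : ~~ arrow g u v.
    by apply/negP => A; have [] := is_set_pos IS lv A; rewrite z.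
  have vu : arrow g v u by move: a; rewrite (ori_orients o).1 /arrows (negPf nuv).
  apply/wp_seq/wp_op; rewrite /aval ?Aa /eval_op ?addn0; [exact: ltnW lu|by []|exact: ltnW lu|].
  set Rb := upd _ _ _; have Ab : (Rb 1 = v) * (Rb 2 = u) by rewrite /Rb /upd /= Aa.
  apply/wp_seq/wp_op; rewrite /aval ?Ab /eval_op ?addn0; [exact: ltnW lv|by []|exact: ltnW lv|].
  set Rc := upd _ _ _; have Ac : (Rc 0 = v) * (Rc 2 = u) by rewrite /Rc /upd /= Ab.
  apply: wp_op; rewrite /aval ?Ac /eval_op ?addn0; [exact: ltnW lu|by []|exact: ltnW lu|].
  by apply: (tail v u); rewrite /upd /= ?Ac // setUC.
move=> z; apply: (tail u v) => //; rewrite ?Aa //.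
by case: (boolP (arrow g u v)) => // nuv; case: z; rewrite (is_set_pos0 IS).
Qed.

(** * Initialisation *)

(** Each vertex gets colour 1 and the palette {1}: [cap] 1, list entry 1, position 1 of colour 1,
    size 1. Everything else is correctly zero from the start. *)
Definition init_body : ins :=
  (IOp 0 OpSub (Rg 0) (Lit 1) ;;
   ISt 0 (Lit 0) (Rg 0) (Lit 1) ;;
   ISt 8 (Rg 0) (Lit 0) (Lit 1) ;;
   ISt 4 (Rg 0) (Lit 0) (Lit 1) ;;
   ISt 5 (Rg 0) (Lit 1) (Lit 1) ;;
   ISt 6 (Rg 0) (Lit 0) (Lit 1))%ins.

Definition init_cmd : cmd :=
  Seq (SetReg len_reg (Bin OpAdd (Reg 0) (Cst 1)))
    (While (Reg 0) (compile init_body)).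

(** The state with the vertices from [k] to [n - 1] done, as the loop counts register 0 down. All
    nonzero cells hold 1, so a boolean describes them. *)
Definition init_arrays (n k : nat) : arrays := fun a x y =>
  [|| [&& a == 0, x == 0 & k <= y < n],
      [&& (a == 8) || (a == 4) || (a == 6), k <= x < n & y == 0]
    | [&& a == 5, k <= x < n & y == 1]].

Definition init_state : dstate :=
  DState (fun _ _ => false) (fun=> 1) (fun _ _ => 0) (fun=> 1) (fun=> 0).

Lemma implements_init n f :
  (forall a x y, f a x y = init_arrays n 0 a x y) -> implements n f init_state.
Proof.
move=> E; split=> [v lv|v lv|v lv|v c lv lc|v lv|v lv]; rewrite ?E /init_arrays /=.
- by rewrite lv.
- by split=> [//|y ly _|i]; rewrite !E.
- have S c : free_hue init_state v c = (c == 1) by rewrite /free_hue /=; lia.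
  split=> [y ly|y ly|i]; rewrite ?S !E /init_arrays /= ?lv /=.
  + by move=> /eqP->.
  + by move=> /negPf->.
  + by case: i => [|i] //= _; split=> //; lia.
- by [].
- by rewrite lv.
- by [].
Qed.

Lemma init_loop n w : num_arrays * n.+1 * n.+1 <= 2 ^ w -> n.+1 < 2 ^ w ->
  forall k s f, k <= n -> regs s 0 = k -> represents w n.+1 s f ->
  (forall a x y, f a x y = init_arrays n k a x y) ->
  exists t s' f', [/\ exec w (While (Reg 0) (compile init_body)) s t s',
    t <= k * (time_bound init_body + 2) + 2, represents w n.+1 s' f'
    & forall a x y, f' a x y = init_arrays n 0 a x y].
Proof.
move=> hw hN; elim=> [|k IH] s f lk R0 rep Ef.
  exists 2, s, f; split=> //; apply: ExecWhileFalse.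
  by rewrite /= R0 mod0n.
have H : wp n.+1 init_body (fun R' f' => R' 0 = k /\
    forall a x y, f' a x y = init_arrays n k a x y) (regs s) f.
  rewrite /= /upd /= R0 subn1 /=; repeat (split; try lia).
  have below_k z : (k <= z < n) = (z == k) || (k.+1 <= z < n) by move: lk; clear; lia.
  move=> a x y; rewrite /write !Ef /init_arrays !below_k.
  case: a => [|[|[|[|[|[|[|[|[|a]]]]]]]]] //=; rewrite ?orbF.
  - by case: (x == 0); case: (y == k).
  - by case: (x == k) => //=; case: (y == 0); rewrite ?andbF.
  - by case: (x == k) => //=; case: (y == 1); rewrite ?andbF.
  - by case: (x == k) => //=; case: (y == 0); rewrite ?andbF.
  - by case: (x == k) => //=; case: (y == 0); rewrite ?andbF.
have [t1 [s1 [f1 [e1 b1 rep1 [R10 Ef1]]]]] := wp_exec (i := init_body) hw hN isT rep H.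
have [t2 [s2 [f2 [e2 b2 rep2 Ef2]]]] := IH s1 f1 (ltnW lk) R10 rep1 Ef1.
exists (2 + t1 + t2), s2, f2; split=> //; last by move: b1 b2; lia.
apply: ExecWhileTrue e1 e2; rewrite /= R0 modn_small //.
by apply: leq_ltn_trans hN; apply: leqW.
Qed.

Lemma init_correct n gamma w :
  num_arrays * n.+1 * n.+1 <= 2 ^ w -> n.+1 < 2 ^ w -> gamma < 2 ^ w ->
  exists t s f, [/\ exec w init_cmd (start_store n gamma) t s,
    t <= (time_bound init_body + 8) * n.+1, represents w n.+1 s f
    & implements n f init_state].
Proof.
move=> hw hN hg; set s0 := start_store n gamma.
have n_w : n < 2 ^ w by apply: ltn_trans hN.
have w1 : 1 < 2 ^ w by apply: leq_ltn_trans hN.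
have ev : eval w s0 (Bin OpAdd (Reg 0) (Cst 1)) = n.+1.
  by rewrite /= /upd /= (modn_small n_w) (modn_small w1) addn1 modn_small.
have ws : word_store w s0.
  by split=> [r|a] /=; rewrite ?expn_gt0 // /upd; do 2!case: eqP => // _; rewrite expn_gt0.
pose f0 : arrays := fun _ _ _ => 0.
have rep : represents w n.+1 (set_reg s0 len_reg n.+1) f0.
  by split=> //; have := word_store_set_reg len_reg (Bin OpAdd (Reg 0) (Cst 1)) ws; rewrite ev.
have Ef a x y : f0 a x y = init_arrays n n a x y by rewrite /init_arrays /f0; lia.
have [t [s [f [e lt rep' E]]]] := init_loop hw hN (leqnn n) (erefl : regs (set_reg s0 len_reg n.+1) 0 = n) rep Ef.
exists (4 + t), s, f; split=> //; [|by move: lt; lia|exact: implements_init].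
by apply: ExecSeq e; have := ExecSetReg w s0 len_reg (Bin OpAdd (Reg 0) (Cst 1)); rewrite ev.
Qed.

Lemma query_correct n w s f (v : 'I_n) :
  num_arrays * n.+1 * n.+1 <= 2 ^ w -> n.+1 < 2 ^ w ->
  represents w n.+1 s f -> regs s 0 = v :> nat ->
  exists t s', [/\ exec w (compile query_ins) s t s', t <= time_bound query_ins,
    represents w n.+1 s' f & regs s' 0 = f 0 0 v].
Proof.
move=> hw hN rep R0.
have H : wp n.+1 query_ins (fun R' f' => f' = f /\ R' 0 = f 0 0 v) (regs s) f.
  by rewrite /= R0 /upd; split=> //; apply: leqW.
have [t [s' [f' [e lt rep' [<- E]]]]] := wp_exec (i := query_ins) hw hN isT rep H.
by exists t, s'.
Qed.

Lemma coloring_hue n w s f g (v : 'I_n) :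
  represents w n.+1 s f -> implements n f g -> coloring s v = hue g v.
Proof.
by move=> rep I; rewrite /coloring -(imp_hue I) // -(rep_mem rep) //; exact: leqW.
Qed.

Lemma represents_set_reg w N s f r x : r != len_reg -> x < 2 ^ w ->
  represents w N s f -> represents w N (set_reg s r x) f.
Proof.
move=> nr lx [h1 h2 [h3 h4]]; split=> //.
  by rewrite /= /upd; case: eqP => // E; rewrite E eqxx in nr.
by split=> //= q; rewrite /upd; case: eqP.
Qed.

Lemma card_adj_degree n (G : graph n) x : #|[set y | adj G x y]| <= degree G x.
Proof.
rewrite -(card_in_imset (f := fun y => [set x; y])).
  apply/subset_leq_card/subsetP => e /imsetP [y]; rewrite !inE => /andP[_ h] ->.
  by rewrite h !inE eqxx.
move=> y z; rewrite !inE => /andP[xy _] /andP[xz _] /eqP; rewrite set2_eq eqxx /=.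
by case/orP=> [/eqP //|/andP[/eqP E _]]; rewrite E eqxx in xz.
Qed.

Lemma card_adj_lt n (G : graph n) x : #|[set y | adj G x y]| < n.
Proof.
rewrite -[ltnRHS](card_ord n) -cardsT; apply: proper_card; rewrite properE subsetT /=.
by apply/subsetPn; exists x; rewrite !inE // /adj eqxx.
Qed.

(** * Amortised analysis *)

Definition coloring_algorithm : algorithm :=
  MkAlgorithm init_cmd insert_cmd (compile delete_ins) (compile query_ins).

Definition flip_cost : nat := time_bound flip_body + 2.

Definition base_cost : nat :=
  time_bound insert_pre + time_bound insert_post + 2 + time_bound delete_ins.

(** The 4 is the factor of [gamma] in the bound on the number of flips plus the change of the
    potential. *)
Definition update_cost : nat := base_cost + 4 * flip_cost.

Lemma Delta_mono n (ops : nat -> op n) i : Delta ops i <= Delta ops i.+1.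
Proof. by rewrite /Delta [leqRHS]big_ord_recr leq_maxl. Qed.

Lemma max_degree_Delta n (ops : nat -> op n) i : max_degree (graph_at ops i) <= Delta ops i.
Proof. by rewrite /Delta big_ord_recr leq_maxr. Qed.

(** The bound [n] makes every colour a valid column of an array; it is affordable because a vertex
    has fewer than [n] neighbours. *)
Definition hue_bound n (ops : nat -> op n) i : nat := minn n (Delta ops i).+1.

Lemma hue_bound_mono n (ops : nat -> op n) i : hue_bound ops i <= hue_bound ops i.+1.
Proof. by have := Delta_mono ops i; rewrite /hue_bound; lia. Qed.

Lemma card_adj_hue_bound n (ops : nat -> op n) i x :
  #|[set y | adj (graph_at ops i) x y]| < hue_bound ops i.
Proof.
rewrite /hue_bound leq_min card_adj_lt ltnS (leq_trans (card_adj_degree _ _)) //.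
by apply: leq_trans (max_degree_Delta ops i); rewrite /max_degree (bigD1 x) //= leq_maxl.
Qed.

(* [phi] counts the arrows of the data structure that disagree with a reference
   orientation of out-degree at most 2 gamma, which the program never sees. *)
Definition good n (gamma w : nat) (ops : nat -> op n) (i : nat) (s : store) (phi : nat) : Prop :=
  exists f g (R : rel 'I_n),
    [/\ represents w n.+1 s f, implements n f g, oriented (graph_at ops i) g,
        bounded (graph_at ops i) (hue_bound ops i) g & proper_hues (graph_at ops i) g] /\
    [/\ orients (graph_at ops i) R, forall x, outdeg R x <= gamma.*2,
        phi = disagreement (@arrows n g) R & forall x, [set x; x] \notin graph_at ops i].

Lemma good_proper n gamma w (ops : nat -> op n) i s phi : good gamma w ops i s phi ->
  proper_coloring (graph_at ops i) (Delta ops i).+1 (coloring s).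
Proof.
move=> [f [g [R [[rep I o B P] _]]]]; split=> [v|u v a]; rewrite !(coloring_hue _ rep I).
  by have := bnd_hue B v; rewrite /hue_bound; lia.
exact: P.
Qed.

Lemma card_recolored n (s s' : store) (u : 'I_n) :
  (forall x, x != u -> @coloring n s x = @coloring n s' x) ->
  #|recolored (@coloring n s) (@coloring n s')| <= 1.
Proof.
move=> E; rewrite -(cards1 u); apply/subset_leq_card/subsetP => x; rewrite !inE.
by apply: contraR => /E ->.
Qed.

Lemma recolored0 n (s s' : store) :
  (forall x, @coloring n s x = @coloring n s' x) ->
  recolored (@coloring n s) (@coloring n s') = set0.
Proof. by move=> E; apply/setP => x; rewrite !inE E eqxx. Qed.

(** Makes [gamma + trunc_log 2 n] positive whenever an edge is updated, so that the constant cost of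
    the update is absorbed. *)
Lemma trunc_log_ord_gt0 n (u v : 'I_n) : u != v -> 0 < trunc_log 2 n.
Proof.
move=> uv; have n2 : 1 < n.
  have := max_card (mem [set u; v]); rewrite card_ord => h.
  by apply: leq_trans h; rewrite -[leqRHS]/(#|[set u; v]|) cards2 uv.
by rewrite trunc_log_gt0 n2.
Qed.

Lemma insert_step n gamma w (ops : nat -> op n) i s phi u v :
  num_arrays * n.+1 * n.+1 <= 2 ^ w -> n.+1 < 2 ^ w -> ops i = Insert u v ->
  legal (graph_at ops i) (ops i) -> arboricity (graph_at ops i.+1) <= gamma ->
  good gamma w ops i s phi ->
  exists t s' phi', [/\ exec w insert_cmd (pass_args (Insert u v) s) t s',
    good gamma w ops i.+1 s' phi', #|recolored (@coloring n s) (@coloring n s')| <= 1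
    & t + flip_cost * phi' <= update_cost * (gamma + trunc_log 2 n) + flip_cost * phi].
Proof.
move=> hw hN Eo leg ag.
have Eg : graph_at ops i.+1 = [set u; v] |: graph_at ops i by rewrite /= Eo.
rewrite Eg in ag; move: leg; rewrite Eo /= => /andP[uv nG].
move=> [f [g [R [[rep I o B P] [oR dR -> nl]]]]].
have u_w x : x < n -> x < 2 ^ w by move=> lx; apply: ltn_trans hN; apply: ltnW.
have db x : #|[set y | adj ([set u; v] |: graph_at ops i) x y]| < hue_bound ops i.+1.
  by rewrite -Eg; apply: card_adj_hue_bound.
have rep' : represents w n.+1 (pass_args (Insert u v) s) f.
  apply: (represents_set_reg (isT : 1 != len_reg) (u_w _ (ltn_ord v))).
  exact: (represents_set_reg (isT : 0 != len_reg) (u_w _ (ltn_ord u)) rep).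
have [t [s' [f' [g' [m [[e rep1 I1 lt] [[o1 B1 P1 h1] pot]]]]]]] :=
  insert_correct hw hN uv nG (hue_bound_mono ops i) (geq_minl n _) db
    rep' I o B P (erefl _) (erefl _).
have [R' [oR' dR' dis]] := reorient_insert uv nG oR dR ag.
exists t, s', (disagreement (@arrows n g') R'); split=> //.
- exists f', g', R'; rewrite Eg; split=> //; split=> // x.
  rewrite !inE negb_or nl andbT set2_eq negb_or !negb_and.
  by case: (eqVneq x u) => [->|] //=; rewrite ?uv ?orbT.
- by apply: (@card_recolored _ _ _ u) => x xu; rewrite (coloring_hue _ rep I) (coloring_hue _ rep1 I1) h1.
have h2 : disagreement (set_arrow (@arrows n g) u v true) (set_arrow R u v true)
    <= disagreement (@arrows n g) R.
  apply/subset_leq_card/subsetP => -[x y]; rewrite !inE /set_arrow /=.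
  by case: ifP.
have h3 := pot _ oR'; have h4 := dR' u.
have h5 := disagreement_triangle (set_arrow (@arrows n g) u v true) (set_arrow R u v true) R'.
have L0 := trunc_log_ord_gt0 uv.
(* The logarithm comes from repairing the reference; [4 * gamma] is twice the out-degree of [u] in
   the repaired reference. *)
have h6 : disagreement (@arrows n g') R' + m <=
          disagreement (@arrows n g) R + trunc_log 2 n + 4 * gamma.
  by move: h2 h3 h4 h5 dis; clear; lia.
move: lt L0 h6; rewrite -/flip_cost /update_cost.
have : time_bound insert_pre + time_bound insert_post + 2 <= base_cost by rewrite leq_addr.
move: (time_bound insert_pre + _ + 2) base_cost flip_cost (disagreement _ _) (disagreement _ _) (trunc_log 2 n).
by clear=> a c k d d' L; nia.
Qed.

Lemma delete_step n gamma w (ops : nat -> op n) i s phi u v :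
  num_arrays * n.+1 * n.+1 <= 2 ^ w -> n.+1 < 2 ^ w -> ops i = Delete u v ->
  legal (graph_at ops i) (ops i) -> good gamma w ops i s phi ->
  exists t s' phi', [/\ exec w (compile delete_ins) (pass_args (Delete u v) s) t s',
    good gamma w ops i.+1 s' phi', #|recolored (@coloring n s) (@coloring n s')| <= 1
    & t + flip_cost * phi' <= update_cost * (gamma + trunc_log 2 n) + flip_cost * phi].
Proof.
move=> hw hN Eo leg; have Eg : graph_at ops i.+1 = graph_at ops i :\ [set u; v] by rewrite /= Eo.
move: leg; rewrite Eo /= => inG.
move=> [f [g [R [[rep I o B P] [oR dR -> nl]]]]].
(* [legal] lets a deletion name any member of the graph; the absence of singletons, kept in [good],
   supplies distinct endpoints. *)
have uv : u != v by apply/eqP => E; have := nl v; rewrite -{1}E inG.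
have u_w x : x < n -> x < 2 ^ w by move=> lx; apply: ltn_trans hN; apply: ltnW.
have rep' : represents w n.+1 (pass_args (Delete u v) s) f.
  apply: (represents_set_reg (isT : 1 != len_reg) (u_w _ (ltn_ord v))).
  exact: (represents_set_reg (isT : 0 != len_reg) (u_w _ (ltn_ord u)) rep).
have [t [s' [f' [g' [[e rep1 I1 lt] [[o1 B1 P1 h1] arr]]]]]] :=
  delete_correct hw hN uv inG (geq_minl n _ : hue_bound ops i <= n) rep' I o B P (erefl _) (erefl _).
pose R' := set_arrow (set_arrow R u v false) v u false.
exists t, s', (disagreement (@arrows n g') R'); split=> //.
- exists f', g', R'; rewrite Eg; split; split=> //.
  + case: B1 => B11 B12 B13; split=> // x.
    * by have := B12 x; have := hue_bound_mono ops i; lia.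
    * by have := B13 x; have := hue_bound_mono ops i; lia.
  + exact: orients_delete.
  + move=> x; apply: leq_trans (dR x); apply: outdeg_sub => y; rewrite /R' /set_arrow.
    by do 2!case: ifP => //.
  + by move=> x; rewrite !inE (negPf (nl x)) andbF.
- by rewrite (@recolored0 n s s') ?cards0 // => x; rewrite (coloring_hue _ rep I) (coloring_hue _ rep1 I1) h1.
have h2 : disagreement (@arrows n g') R' <= disagreement (@arrows n g) R.
  apply/subset_leq_card/subsetP => -[x y]; rewrite !inE arr /R' /set_arrow /=.
  by do 2!case: ifP => //.
have L0 := trunc_log_ord_gt0 uv.
move: lt L0 h2; rewrite /update_cost.
have : time_bound delete_ins <= base_cost by rewrite leq_addl.
move: (time_bound delete_ins) base_cost flip_cost (disagreement _ _) (disagreement _ _) (trunc_log 2 n).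
by clear=> a c k d d' L; nia.
Qed.

Lemma query_step n gamma w (ops : nat -> op n) i s phi v :
  num_arrays * n.+1 * n.+1 <= 2 ^ w -> n.+1 < 2 ^ w -> ops i = Query v ->
  good gamma w ops i s phi ->
  exists t s', [/\ exec w (compile query_ins) (pass_args (Query v) s) t s',
    good gamma w ops i.+1 s' phi, t <= time_bound query_ins
    & answer s' = coloring s v /\ recolored (@coloring n s) (@coloring n s') = set0].
Proof.
move=> hw hN Eo [f [g [R [[rep I o B P] [oR dR -> nl]]]]].
have Eg : graph_at ops i.+1 = graph_at ops i by rewrite /= Eo.
have v_w : v < 2 ^ w by apply: ltn_trans hN; rewrite ltnS ltnW.
have rep' : represents w n.+1 (pass_args (Query v) s) f by apply: represents_set_reg.
have [t [s' [e lt rep1 E]]] := query_correct hw hN rep' (erefl : regs (pass_args (Query v) s) 0 = v).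
exists t, s'; split=> //.
  exists f, g, R; rewrite Eg; split=> //; split=> //.
  case: B => B1 B2 B3; split=> // x.
  - by have := B2 x; have := hue_bound_mono ops i; lia.
  - by have := B3 x; have := hue_bound_mono ops i; lia.
split; first by rewrite /answer E (coloring_hue _ rep I) (imp_hue I).
by apply: recolored0 => x; rewrite (coloring_hue _ rep I) (coloring_hue _ rep1 I).
Qed.

Lemma adj_set0 n (x y : 'I_n) : adj set0 x y = false.
Proof. by rewrite /adj inE andbF. Qed.

Lemma good_init n gamma w (ops : nat -> op n) s f :
  represents w n.+1 s f -> implements n f init_state -> good gamma w ops 0 s 0.
Proof.
move=> rep I; exists f, init_state, (fun _ _ => false).
have n0 (v : 'I_n) : 0 < hue_bound ops 0.
  by rewrite /hue_bound leq_min andbT; apply: leq_trans (ltn_ord v).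
have adj0 (x : 'I_n) : [set y | adj (set0 : graph n) x y] = set0.
  by apply/setP => y; rewrite !inE adj_set0.
split; split=> //.
- split=> //; first by split=> // x y; rewrite adj_set0.
  by move=> v c _; rewrite /= (_ : [set _ | _] = set0) ?cards0 //; apply/setP => x; rewrite !inE.
- by split=> v //=; rewrite ?adj0 ?cards0 // n0.
- by move=> x y; rewrite adj_set0.
- by split=> x y; rewrite ?adj_set0.
- by move=> x; rewrite /outdeg (_ : [set _ | _] = set0) ?cards0 //; apply/setP => y; rewrite !inE.
- by rewrite /disagreement (_ : [set _ | _] = set0) ?cards0 //; apply/setP => y; rewrite !inE.
- by move=> x; rewrite inE.
Qed.

Lemma num_updatesS n (ops : nat -> op n) m :
  num_updates ops m.+1 = num_updates ops m + is_update (ops m).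
Proof.
have E T : num_updates ops T = \sum_(i < T) is_update (ops i).
  by rewrite /num_updates -sum1dep_card big_mkcond /=; apply: eq_bigr => i _; case: ifP.
by rewrite !E big_ord_recr.
Qed.

(** Origin of the constant 8: P exceeds [n] and is at least 2, so in P^8 a factor P^4 >= 16 covers
    the 10 arrays and the remaining P^4 covers the square of [n.+1]. *)
Lemma word_size n w : 8 * (trunc_log 2 n).+1 <= w ->
  num_arrays * n.+1 * n.+1 <= 2 ^ w /\ n.+1 < 2 ^ w.
Proof.
set P := 2 ^ (trunc_log 2 n).+1 => hw.
have nP : n.+1 <= P by apply: trunc_log_ltn.
have P2 : 2 <= P by rewrite -[leqLHS]/(2 ^ 1) leq_exp2l.
have : P ^ 8 <= 2 ^ w by rewrite -expnM leq_exp2l // mulnC.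
have P4 : 16 <= P ^ 4 by rewrite -[leqLHS]/(2 ^ 4) leq_exp2r.
have -> : P ^ 8 = P ^ 4 * (P ^ 2 * P ^ 2) by rewrite -!expnD.
rewrite /num_arrays -(mulnn P) => le.
have P22 : 4 <= P * P by rewrite -[leqLHS]/(2 * 2) leq_mul.
by split; apply: leq_trans le; nia.
Qed.

Record step_spec n (w C : nat) (ops : nat -> op n) (i : nat) (s : store) (t : nat)
    (s' : store) : Prop := StepSpec {
  step_exec : exec w (prog_of coloring_algorithm (ops i)) (pass_args (ops i) s) t s';
  step_recolored : is_update (ops i) ->
    #|recolored (@coloring n s) (@coloring n s')| <= 1;
  step_query : forall v, ops i = Query v ->
    answer s' = coloring s v /\
    recolored (@coloring n s) (@coloring n s') = set0 /\ t <= C }.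

Lemma good_step n gamma w (ops : nat -> op n) i s phi :
  num_arrays * n.+1 * n.+1 <= 2 ^ w -> n.+1 < 2 ^ w ->
  legal (graph_at ops i) (ops i) -> arboricity (graph_at ops i.+1) <= gamma ->
  good gamma w ops i s phi ->
  exists t s' phi', [/\ step_spec w (time_bound query_ins) ops i s t s',
    good gamma w ops i.+1 s' phi'
    & (if is_update (ops i) then t else 0) + flip_cost * phi' <=
      update_cost * (gamma + trunc_log 2 n) * is_update (ops i) + flip_cost * phi].
Proof.
move=> hw hN leg ag gd; case Eo: (ops i) => [u v|u v|v].
- have [t [s' [phi' [e gd' rc pot]]]] := insert_step hw hN Eo leg ag gd.
  by exists t, s', phi'; split=> //=; [split; rewrite Eo|rewrite muln1].
- have [t [s' [phi' [e gd' rc pot]]]] := delete_step hw hN Eo leg gd.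
  by exists t, s', phi'; split=> //=; [split; rewrite Eo|rewrite muln1].
- have [t [s' [e gd' lt [an rc]]]] := query_step hw hN Eo gd.
  exists t, s', phi; split=> //=; last by rewrite muln0.
  by split; rewrite Eo // => v' [<-].
Qed.

(** The potential starts at 0, so the step bounds telescope to a bound on the total time. The
    intermediate invariants are kept because the colouring must be proper at every moment. *)
Lemma good_run n gamma w (ops : nat -> op n) T s0 :
  num_arrays * n.+1 * n.+1 <= 2 ^ w -> n.+1 < 2 ^ w ->
  admissible gamma ops T -> good gamma w ops 0 s0 0 ->
  forall m, m <= T -> exists (s : nat -> store) (t : nat -> nat),
    [/\ s 0 = s0,
        forall i, i < m -> step_spec w (time_bound query_ins) ops i (s i) (t i) (s i.+1),
        forall i, i < m -> exists phi, good gamma w ops i (s i) phi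
      & exists2 phi, good gamma w ops m (s m) phi &
        \sum_(i < m | is_update (ops i)) t i + flip_cost * phi <=
        update_cost * (gamma + trunc_log 2 n) * num_updates ops m].
Proof.
move=> hw hN adm gd0; elim=> [|m IH] lm.
  exists (fun=> s0), (fun=> 0); split=> //; exists 0 => //.
  by rewrite big_ord0 muln0.
have [s [t [s0E st gd [phi gdm pot]]]] := IH (ltnW lm).
have [leg ag] := adm m lm.
have [tm [sm [phi' [stm gd' pot']]]] := good_step hw hN leg ag gdm.
have split_last i : i < m.+1 -> i = m \/ i < m.
  by rewrite ltnS leq_eqVlt => /orP[/eqP|]; [left|right].
exists (fun i => if i <= m then s i else sm), (fun i => if i < m then t i else tm).
split=> //.
- move=> i /split_last[->|lt].
    by rewrite /= leqnn !ltnn.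
  by rewrite /= (ltnW lt) lt; apply: st.
- move=> i /split_last[->|lt]; first by rewrite /= leqnn; exists phi.
  by rewrite /= (ltnW lt); apply: gd.
rewrite /= ltnn; exists phi' => //.
rewrite big_mkcond big_ord_recr -big_mkcond /= ltnn num_updatesS mulnDr.
rewrite (eq_bigr (fun i : 'I_m => t i)); last by move=> i _; rewrite ltn_ord.
rewrite -addnA; apply: leq_trans (leq_add (leqnn _) pot') _.
by rewrite addnCA addnC leq_add2r.
Qed.

Theorem theorem7 :
  exists (A : algorithm) (C k : nat),
  forall n gamma w : nat,
  k * (trunc_log 2 n).+1 <= w -> gamma < 2 ^ w ->
  exists (s0 : store) (t0 : nat),
    exec w (init_prog A) (start_store n gamma) t0 s0 /\
    t0 <= C * n.+1 /\
    forall (ops : nat -> op n) (T : nat),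
    admissible gamma ops T ->
    exists (s : nat -> store) (t : nat -> nat),
      s 0 = s0 /\
      (forall i, i < T ->
         exec w (prog_of A (ops i)) (pass_args (ops i) (s i)) (t i) (s i.+1)) /\
      (forall i, i <= T ->
         proper_coloring (graph_at ops i) (Delta ops i).+1 (coloring (s i))) /\
      (forall i, i < T -> is_update (ops i) ->
         #|recolored (@coloring n (s i)) (@coloring n (s i.+1))| <= 1) /\
      \sum_(i < T | is_update (ops i)) t i
        <= C * (gamma + trunc_log 2 n) * num_updates ops T /\
      (forall i (v : 'I_n), i < T -> ops i = Query v ->
         answer (s i.+1) = coloring (s i) v /\
         recolored (@coloring n (s i)) (@coloring n (s i.+1)) = set0 /\
         t i <= C).
Proof.
(* One constant serves updates, initialisation and queries alike; each bound drops the other two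
   summands. *)
pose C := update_cost + (time_bound init_body + 8) + time_bound query_ins.
exists coloring_algorithm, C, 8 => n gamma w /word_size [hw hN] hg.
have [t0 [s0 [f0 [e0 lt0 rep0 I0]]]] := init_correct hw hN hg.
exists s0, t0; split=> //; split.
  by apply: leq_trans lt0 _; rewrite leq_mul2r /C; apply/orP; right; rewrite addnAC leq_addl.
move=> ops T adm; have gd0 := good_init gamma ops rep0 I0.
have [s [t [s0E st gd [phi gdT pot]]]] := good_run hw hN adm gd0 (leqnn T).
exists s, t; split; [exact: s0E|split; first by move=> i /st []].
split.
  move=> i; rewrite leq_eqVlt => /orP[/eqP->|/gd [psi gi]]; first exact: good_proper gdT.
  exact: good_proper gi.
split; first by move=> i /st [].
split.
  apply: leq_trans (leq_trans (leq_addr _ _) pot) _.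
  by rewrite !leq_mul2r /C -addnA leq_addr !orbT.
move=> i v /st [_ _ q] /q [-> [-> lt]]; split=> //; split=> //.
by apply: leq_trans lt _; rewrite leq_addl.
Qed.
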